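(* Let $n,m,k,l$ be positive integers with $1\le l\le k$. Then, with all ideals taken in $A=\mathbb{F}_2[t_1,\ldots,t_k]$: (a) if $$\prod_{\substack{s_1,\ldots,s_k\in\{0,1\}\\ 1\le s_1+\cdots+s_k\le l}}(s_1t_1+s_2t_2+\cdots+s_kt_k)^m\notin\langle t_1^{n+1},\ldots,t_k^{n+1}\rangle,$$ then $(n,m,k,l)\in\mathcal{M}$; (b) if $$\frac{1}{t_1\cdots t_k}\prod_{\substack{s_1,\ldots,s_k\in\{0,1\}\\ 1\le s_1+\cdots+s_k\le l}}(s_1t_1+s_2t_2+\cdots+s_kt_k)^m\notin\langle\bar w_{n-k+1},\ldots,\bar w_n\rangle,$$ then $(n,m,k,l)\in\mathcal{M}^{orth}$. (In the index sets of the products, $s_1+\cdots+s_k$ is the sum of integers.)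
   Context: An affine hyperplane $H=\{x\in\mathbb{R}^n:\langle x,v\rangle=\alpha\}$ ($v\neq0$) determines the open halfspaces $H^{-}=\{\langle x,v\rangle<\alpha\}$ and $H^{+}=\{\langle x,v\rangle>\alpha\}$. An orthant of an arrangement $\{H_1,\ldots,H_r\}$ of affine hyperplanes is an intersection $H_1^{\alpha_1}\cap\cdots\cap H_r^{\alpha_r}$ with $\alpha_j\in\{+,-\}$ (there are $2^r$ orthants, indexed by $(\alpha_1,\ldots,\alpha_r)$, possibly empty). The arrangement equiparts a measure $\mu$ on $\mathbb{R}^n$ if $\mu(\mathcal{O})=2^{-r}\mu(\mathbb{R}^n)$ for each of its orthants $\mathcal{O}$. $\mathcal{M}$ (respectively $\mathcal{M}^{orth}$) is the set of quadruples $(n,m,k,l)$ of positive integers with $1\le l\le k$ such that for every collection of $m$ absolutely continuous probability measures $\mu_1,\ldots,\mu_m$ on $\mathbb{R}^n$ there exist $k$ hyperplanes (respectively $k$ mutually orthogonal hyperplanes) $H_1,\ldots,H_k$ such that any $l$ of them equipart all the measures. $A=\mathbb{F}_2[t_1,\ldots,t_k]$ is the polynomial algebra with $\deg t_i=1$; $w_1=t_1+\cdots+t_k,\ldots,w_k=t_1\cdots t_k$ are the elementary symmetric polynomials. For $r\ge1$, $$\bar w_r=\sum_{\substack{i_1,\ldots,i_k\ge0\\ i_1+2i_2+\cdots+ki_k=r}}\binom{i_1+\cdots+i_k}{i_1\ i_2\ \ldots\ i_k}\,w_1^{i_1}\cdots w_k^{i_k}\in A,$$ where $\binom{i_1+\cdots+i_k}{i_1\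 \ldots\ i_k}=\frac{(i_1+\cdots+i_k)!}{i_1!\cdots i_k!}$ is taken modulo $2$. Conventions: $\bar w_0=1$ and $\bar w_r=0$ for $r<0$. *)

(* Defs.v *)
From HB Require Import structures.
From mathcomp Require Import all_boot all_order all_algebra.
(* The notations of mpoly clash with those of the analysis library, and it must come
   first because both define isMeasure. *)
From mathcomp Require Import -(notations) mpoly.
From mathcomp Require Import all_classical all_reals all_analysis.

Set Implicit Arguments.
Unset Strict Implicit.
Unset Printing Implicit Defensive.

Import Order.TTheory GRing.Theory Num.Theory.

Local Open Scope classical_set_scope.
Local Open Scope ring_scope.

(* R^n carries the sigma-algebra generated by the coordinates, i.e. the Borel
   sets; measurableTypeR R is R itself with its Borel sigma-algebra. *)
Notation Rn R n := (n.-tuple (measurableTypeR R)).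

Definition dot (R : realType) (n : nat) (x y : Rn R n) : R :=
  \sum_(i < n) (tnth x i : R) * (tnth y i : R).

Definition tcons (R : realType) (n : nat) (p : measurableTypeR R * Rn R n) :
    Rn R n.+1 :=
  [the n.+1.-tuple _ of p.1 :: p.2].

(* n-dimensional Lebesgue measure, by iterated products; lebesgueRn_box gives
   its value on boxes. *)
Fixpoint lebesgueRn (R : realType) (n : nat) : set (Rn R n) -> \bar R :=
  if n is n'.+1 then
    pushforward (@lebesgue_measure R \x @lebesgueRn R n')%E (@tcons R n')
  else \d_([tuple] : Rn R 0).


Lemma measurable_tcons (R : realType) (n : nat) :
  measurable_fun [set: measurableTypeR R * Rn R n] (@tcons R n).
Proof. exact: measurable_cons. Qed.

Lemma measurable_thead (R : realType) (n : nat) :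
  measurable_fun [set: Rn R n.+1] (fun x => (thead x, [tuple of behead x])).
Proof.
apply/measurable_fun_pairP; split; first exact: measurable_tnth.
exact: measurable_behead.
Qed.

Lemma tconsK (R : realType) (n : nat) :
  cancel (@tcons R n) (fun x => (thead x, [tuple of behead x])).
Proof. by case=> a t /=; congr (_, _); apply: val_inj. Qed.

Lemma theadK (R : realType) (n : nat) :
  cancel (fun x : Rn R n.+1 => (thead x, [tuple of behead x])) (@tcons R n).
Proof. by move=> x; rewrite [RHS]tuple_eta. Qed.

Lemma sigma_finite_measureP (d : measure_display) (T : measurableType d) (R : realType)
    (m : set T -> \bar R) :
  m set0 = 0%E -> (forall A, 0 <= m A)%E -> semi_sigma_additive m ->
  sigma_finite setT m ->
  exists nu : {sigma_finite_measure set T -> \bar R}, nu = m :> (set T -> _).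
Proof.
move=> m0 m_ge0 m_sa m_sf.
pose mM := isMeasure.Build _ _ _ m m0 m_ge0 m_sa.
pose M : {measure set T -> \bar R} := HB.pack m mM.
pose mS := Measure_isSigmaFinite.Build _ _ _ M m_sf.
by exists (HB.pack_for {sigma_finite_measure set T -> \bar R} m mM mS).
Qed.

Lemma lebesgueRn_sigma_finite (R : realType) (n : nat) :
  exists nu : {sigma_finite_measure set (Rn R n) -> \bar R},
    nu = @lebesgueRn R n :> (set (Rn R n) -> \bar R).
Proof.
elim: n => [|n [nu nuE]]; first by exists \d_([tuple] : Rn R 0).
have mc := @measurable_tcons R n.
pose P : {measure set (measurableTypeR R * Rn R n)%type -> \bar R} :=
  (@lebesgue_measure R \x nu)%E.
pose m := pushforward P (@tcons R n).
have m0 : m set0 = 0%E by rewrite /m /pushforward preimage_set0 measure0.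
have m_ge0 A : (0 <= m A)%E by exact: measure_ge0.
have m_sa : semi_sigma_additive m.
  move=> F mF tF mUF; rewrite /m /pushforward preimage_bigcup.
  apply: measure_semi_sigma_additive.
  - by move=> i; rewrite -[X in measurable X]setTI; exact: mc.
  - apply/trivIsetP => /= i j _ _ ij; rewrite -preimage_setI.
    by move/trivIsetP : tF => /(_ _ _ _ _ ij) ->//; rewrite preimage_set0.
  - by rewrite -preimage_bigcup -[X in measurable X]setTI; exact: mc.
have m_sf : sigma_finite setT m.
  have /sigma_finiteP[F [TF ndF Foo]] := sigma_finiteT (@lebesgue_measure R).
  have /sigma_finiteP[G [TG ndG Goo]] := sigma_finiteT nu.
  exists (fun i => (fun x => (thead x, [tuple of behead x])) @^-1`
      (F i `*` G i)).
    apply/esym/seteqP; split => // x _.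
    have [i _ Fi] : (\bigcup_i F i) (thead x) by rewrite -TF.
    have [j _ Gj] : (\bigcup_i G i) [tuple of behead x] by rewrite -TG.
    exists (maxn i j) => //; split => /=.
    - by move: Fi; exact/subsetPset/ndF/leq_maxl.
    - by move: Gj; exact/subsetPset/ndG/leq_maxr.
  move=> i; have [mFi Fi] := Foo i; have [mGi Gi] := Goo i; split.
    rewrite -[X in measurable X]setTI; apply: measurable_thead => //.
    exact: measurableX.
  rewrite /m /pushforward -comp_preimage (_ : _ \o _ = id); last first.
    by apply/funext => p; exact: tconsK.
  by rewrite /P /= product_measure1E// lte_mul_pinfty// ge0_fin_numE.
have [S SE] := sigma_finite_measureP m0 m_ge0 m_sa m_sf.
by exists S; rewrite SE /m /P /= nuE.
Qed.

Lemma lebesgueRn_box (R : realType) (n : nat) (A : 'I_n -> set (measurableTypeR R)) :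
  (forall i, measurable (A i)) ->
  lebesgueRn [set x : Rn R n | forall i, A i (tnth x i)] =
    (\prod_(i < n) lebesgue_measure (A i))%E.
Proof.
elim: n A => [|n IH] A mA.
  by rewrite big_ord0 /= diracE mem_set// => -[].
have [nu nuE] := lebesgueRn_sigma_finite R n.
rewrite big_ord_recl -IH// /= -nuE -product_measure1E//; last first.
  rewrite (_ : mkset _ = \bigcap_(i in [set: 'I_n])
      ((fun x : Rn R n => tnth x i) @^-1` A (lift ord0 i))).
    apply: fin_bigcap_measurable => // i _.
    by rewrite -[X in measurable X]setTI; exact: measurable_tnth.
  by apply/seteqP; split => [x Hx i _|x Hx i]; [exact: Hx|exact: (Hx i Logic.I)].
rewrite /pushforward; congr ((_ \x _)%E _).
apply/seteqP; split => [[a t] H|[a t] [H0 H] i] /=.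
  split; first exact: (H ord0).
  by move=> i; have := H (lift ord0 i); rewrite tnthS.
by case: (unliftP ord0 i) => [j ->|->] //; rewrite tnthS; exact: H.
Qed.

Record hyperplane (R : realType) (n : nat) := Hyperplane {
  normal : Rn R n;
  offset : R;
  normal_neq0 : exists i : 'I_n, tnth normal i != 0 :> R }.

(* halfspace H true is H^+ and halfspace H false is H^-; replacing (v, alpha)
   by (- v, - alpha) exchanges the two, which permutes the orthants. *)
Definition halfspace (R : realType) (n : nat) (H : hyperplane R n) (a : bool) :
    set (Rn R n) :=
  if a then [set x | dot x (normal H) > offset H]
  else [set x | dot x (normal H) < offset H].

Definition orthant (R : realType) (n r : nat) (H : 'I_r -> hyperplane R n)
    (a : 'I_r -> bool) : set (Rn R n) :=
  \bigcap_(j in [set: 'I_r]) halfspace (H j) (a j).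

Definition equiparts (R : realType) (n r : nat) (H : 'I_r -> hyperplane R n)
    (mu : set (Rn R n) -> \bar R) : Prop :=
  forall a : 'I_r -> bool,
    mu (orthant H a) = ((2 ^- r)%:E * mu [set: Rn R n])%E.

Definition mutually_orthogonal (R : realType) (n k : nat)
    (H : 'I_k -> hyperplane R n) : Prop :=
  forall i j : 'I_k, i != j -> dot (normal (H i)) (normal (H j)) = 0.

(* Choosing l of the k hyperplanes is choosing l distinct indices: the
   hyperplanes form a family and may coincide when l = 1. *)
Definition any_equipart (R : realType) (n m k l : nat)
    (mu : 'I_m -> probability (Rn R n) R) (H : 'I_k -> hyperplane R n) : Prop :=
  forall f : 'I_l -> 'I_k, injective f ->
  forall i : 'I_m, equiparts (fun j => H (f j)) (mu i).

Definition admissible (n m k l : nat) : Prop :=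
  [/\ (0 < n)%N, (0 < m)%N & (1 <= l <= k)%N].

Definition calM (R : realType) (n m k l : nat) : Prop :=
  admissible n m k l /\
  forall mu : 'I_m -> probability (Rn R n) R,
    (forall i, mu i `<< @lebesgueRn R n) ->
    exists H : 'I_k -> hyperplane R n, any_equipart l mu H.

Definition calMorth (R : realType) (n m k l : nat) : Prop :=
  admissible n m k l /\
  forall mu : 'I_m -> probability (Rn R n) R,
    (forall i, mu i `<< @lebesgueRn R n) ->
    exists H : 'I_k -> hyperplane R n,
      mutually_orthogonal H /\ any_equipart l mu H.

Definition in_ideal (A : comNzRingType) (r : nat) (g : 'I_r -> A) (x : A) :
    Prop :=
  exists c : 'I_r -> A, x = \sum_(i < r) c i * g i.

Notation polyA k := (mpoly k 'F_2).

(* tvar i is t_{i+1}. *)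
Definition tvar (k : nat) (i : 'I_k) : polyA k :=
  mpolyX 'F_2 (mnm1 i).

Definition wsym (k j : nat) : polyA k := mesym k 'F_2 j.

(* The exponent i_{j+1} of w_{j+1} is i j; the condition on the weighted sum
   forces every exponent to be at most r. *)
Definition wbar_nat (k r : nat) : polyA k :=
  \sum_(i : {ffun 'I_k -> 'I_r.+1} | (\sum_(j < k) j.+1 * i j == r)%N)
    (\prod_(j < k) wsym k j.+1 ^+ i j)
      *+ ((\sum_(j < k) i j)`! %/ \prod_(j < k) (i j)`!)%N.

Definition wbar (k : nat) (r : int) : polyA k :=
  if r is Posz r' then wbar_nat k r' else 0.

Definition sprod (m k l : nat) : polyA k :=
  \prod_(s : {ffun 'I_k -> bool} | (1 <= \sum_(j < k) s j <= l)%N)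
    (\sum_(j < k) tvar j *+ s j) ^+ m.

Lemma wbar0 (k : nat) : wbar k 0 = 1.
Proof.
have z0 (x : 'I_1) : (x : nat) = 0%N by case: x => -[].
rewrite /wbar /= /wbar_nat (big_pred1 [ffun=> ord0]) => [|i]; last first.
  rewrite [LHS](_ : _ = true) ?[RHS](_ : _ = true)//.
    by apply/eqP/ffunP => j; apply/val_inj; rewrite ffunE /= z0.
  by rewrite big1// => j _; rewrite z0 muln0.
rewrite big1 => [|j _]; last by rewrite z0 expr0.
by rewrite !big1 // => j _; rewrite z0.
Qed.

Lemma prod_t_neq0 (k : nat) : \prod_(i < k) tvar i != 0.
Proof.
apply/prodf_neq0 => i _; apply/eqP => /(congr1 (mcoeff (mnm1 i))).
by rewrite mcoeffX eqxx mcoeff0 => /eqP; rewrite oner_eq0.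
Qed.

(* The quotient of sprod m k l by t_1 ... t_k is a well-defined polynomial. *)
Lemma prod_t_dvd_sprod (m k l : nat) : (0 < m)%N -> (1 <= l)%N ->
  exists! q : polyA k, (\prod_(i < k) tvar i) * q = sprod m k l.
Proof.
case: m => // m _ l1.
pose e (i : 'I_k) : {ffun 'I_k -> bool} := [ffun j => j == i].
have e_inj : injective e.
  by move=> i j /ffunP/(_ i); rewrite !ffunE eqxx => /esym/eqP.
have sume i : (\sum_(j < k) e i j = 1)%N.
  by rewrite (bigD1 i)//= ffunE eqxx big1// => j /negbTE ji; rewrite ffunE ji.
have lin i : \sum_(j < k) tvar j *+ e i j = tvar i.
  rewrite (bigD1 i)//= ffunE eqxx mulr1n big1 ?addr0// => j /negbTE ji.
  by rewrite ffunE ji mulr0n.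
suff [q qE] : exists q : polyA k, (\prod_(i < k) tvar i) * q = sprod m.+1 k l.
  exists q; split=> // q' q'E; apply: (mulfI (prod_t_neq0 k)).
  by rewrite qE q'E.
rewrite /sprod (bigID (mem [set e i | i in 'I_k]%SET)) /=.
rewrite (eq_bigl (mem [set e i | i in 'I_k]%SET)) => [|s]; last first.
  rewrite andb_idl// => /imsetP[i _ ->].
  by rewrite sume.
rewrite big_imset /=; last by move=> i j _ _; exact: e_inj.
rewrite [X in X * _](eq_bigr (fun i => tvar i * tvar i ^+ m)) => [|i _]; last first.
  by rewrite lin exprS.
by rewrite big_split /= -mulrA; eexists.
Qed.

(* Main.v *)
Require Import Defs.
From mathcomp Require Import all_boot all_order all_algebra.
From mathcomp Require Import -(notations) mpoly.
From mathcomp Require Import all_classical all_reals all_analysis.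
From mathcomp Require Import measurable_realfun.
From mathcomp Require Import ring zify.

(* Row [i] of a point of a product of cross-polytope boundaries encodes the i-th
   hyperplane.  The means of products of the signs of the affine forms over at most
   [l] rows vanish exactly when any [l] hyperplanes equipart, and (Z/2)^k acts on each
   mean by a character; orthogonality of the normals adds equations whose characters
   are t_i + t_j.  A common zero is found by a Borsuk-Ulam argument.  If [s_j] is the
   sign of the j-th function, the cochain with value
   (s_1 v_0 + s_1 v_1) ... (s_N v_(N-1) + s_N v_N) on (v_0, ..., v_N) is an invariant
   cocycle; on the product of the fundamental cycles of projective spaces of
   dimensions [a i] it evaluates to the coefficient of t^a in the product of the
   characters.  Barycentric subdivision preserves this value, so if it is nonzero
   there are arbitrarily small simplices on which all the functions change sign.

   For mutually orthogonal hyperplanes the product of the characters is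
   t_1 ... t_k q Delta with Delta the product of the t_i + t_j, i < j.  Modulo 2,
   the class [wbar r] is the complete homogeneous polynomial h_r, and
   h_r(t_i, ..., t_k) lies in the ideal of the [wbar]s for the r = n - k + i with
   leading term t_i ^ r; hence [q] is congruent to a polynomial [p] with small leading
   exponents, and the leading monomial of [p] Delta is not in <t_1^n, ..., t_k^n>,
   whereas h_r Delta is. *)

Set Implicit Arguments.
Unset Strict Implicit.
Unset Printing Implicit Defensive.

Import Order.TTheory GRing.Theory Num.Theory.

Local Open Scope ring_scope.

(** * Cochains modulo 2 *)

Lemma F2_addrr (x : 'F_2) : x + x = 0.
Proof. by apply: addrr_pchar2; apply: pchar_Fp. Qed.

Lemma F2_addr0 (x y : 'F_2) : x + y = 0 -> x = y.
Proof. by move=> h; rewrite -[x]addr0 -(F2_addrr y) addrA h add0r. Qed.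

Lemma F2_cases (x : 'F_2) : x = 0 \/ x = 1.
Proof. by case: x => -[|[|[]]]// i; [left|right]; apply: val_inj. Qed.

Ltac f2_cases :=
  repeat match goal with x : _ |- _ => destruct (F2_cases x); subst x end;
  by apply/eqP.

Section Cochains.
Variable P : Type.
Implicit Types (f g h : seq P -> 'F_2) (u v : seq P) (s : P -> 'F_2).

Fixpoint coboundary f v : 'F_2 :=
  if v is x :: v' then f v' + coboundary (fun u => f (x :: u)) v' else 0.

Lemma eq_coboundary f g v :
  (forall u, size u = (size v).-1 -> f u = g u) ->
  coboundary f v = coboundary g v.
Proof.
elim: v f g => //= x v ih f g fg; rewrite fg//; congr (_ + _).
case: v ih fg => [//|y v] ih fg.
by apply: ih => u su; apply: fg; rewrite /= su.
Qed.

Lemma coboundaryD f g v :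
  coboundary (fun u => f u + g u) v = coboundary f v + coboundary g v.
Proof. by elim: v f g => [|x v ih] f g /=; rewrite ?addr0// ih addrACA. Qed.

Lemma coboundaryM (a : 'F_2) f v :
  coboundary (fun u => a * f u) v = a * coboundary f v.
Proof. by elim: v f => [|x v ih] f /=; rewrite ?mulr0// ih mulrDr. Qed.

Lemma coboundary0 v : coboundary (fun=> 0) v = 0.
Proof. by elim: v => //= x v ->; rewrite addr0. Qed.

Lemma coboundaryK f v : coboundary (coboundary f) v = 0.
Proof.
elim: v f => //= x v ih f.
by rewrite coboundaryD ih addr0 F2_addrr.
Qed.

(** The cup product of the coboundary of the 0-cochain [s] with [f]. *)
Definition cup s f v : 'F_2 :=
  if v is x :: (y :: _) as v' then (s x + s y) * f v' else 0.

(** The coboundary of [s] is a cocycle, so only [f] gets differentiated. On two entries the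
    right-hand side would involve [f [::]], whence the bound on the size. *)
Lemma coboundary_cup s f v : (2 < size v)%N ->
  coboundary (cup s f) v = cup s (coboundary f) v.
Proof.
case: v => [//|x [//|y [//|z v]]] _ /=.
rewrite coboundaryM.
move: (f (z :: v)) (f (y :: v)) (coboundary _ _) (s x) (s y) (s z).
move=> a a' b c d e.
clear; f2_cases.
Qed.

Fixpoint cups (ss : seq (P -> 'F_2)) : seq P -> 'F_2 :=
  if ss is s :: ss' then cup s (cups ss') else fun=> 1.

Lemma coboundary_cups ss v : size v = (size ss).+2 -> coboundary (cups ss) v = 0.
Proof.
elim: ss v => [|s ss ih] v /= sv.
  by case: v sv => [|x [|y []]]//= _; rewrite addr0 F2_addrr.
rewrite coboundary_cup ?sv//; case: v sv => [|x [|y v]]//= [sv].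
by rewrite -[X in _ * X]/(coboundary (cups ss) (y :: v)) ih ?mulr0//= sv.
Qed.

Definition scale s f v : 'F_2 := if v is x :: _ then s x * f v else 0.

(** The Leibniz rule for the product of the 0-cochain [s] with [f], at a simplex where the
    coboundary of [f] vanishes. *)
Lemma coboundary_scale s f v : coboundary f v = 0 -> (1 < size v)%N ->
  coboundary (scale s f) v = cup s f v.
Proof.
case: v => [//|x [//|y v]] /= h _; rewrite coboundaryM.
move: h; move: (f (y :: v)) (coboundary _ _) (f (x :: v)) (s x) (s y).
move=> a b c d e; move=> h; have {h}-> : a = c + b by apply: F2_addr0.
clear; f2_cases.
Qed.

End Cochains.

Section Invariance.
Variables (P G : Type) (g : G -> P -> P).
Implicit Types (f : seq P -> 'F_2) (s : P -> 'F_2) (c : G -> 'F_2).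

Definition invariant_cochain f := forall a v, f (map (g a) v) = f v.

(** In the application [G] indexes the generators of (Z/2)^k, and [c] is a character given by its
    values on them. *)
Definition equivariant c s := forall a x, s (g a x) = s x + c a.

Lemma invariant_cup c s f :
  equivariant c s -> invariant_cochain f -> invariant_cochain (cup s f).
Proof.
move=> sc fi a [|x [|y v]] //=; rewrite -[f _]/(f (map (g a) (y :: v))) fi.
by rewrite !sc addrACA F2_addrr addr0.
Qed.

Variables (J : Type) (c : J -> G -> 'F_2) (s : J -> P -> 'F_2).
Hypothesis sc : forall j, equivariant (c j) (s j).

Lemma invariant_cups js : invariant_cochain (cups (map s js)).
Proof. by elim: js => [|j js ih] //=; apply: invariant_cup (sc j) ih. Qed.

End Invariance.

Section Cohomologous.
Variables (P G : Type) (g : G -> P -> P).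
Variables (J : Type) (c : J -> G -> 'F_2) (s s' : J -> P -> 'F_2).
Hypothesis sc : forall j, equivariant g (c j) (s j).
Hypothesis s'c : forall j, equivariant g (c j) (s' j).

(** The sum [r] of two functions with the same character is an invariant 0-cochain. With A, A' the
    products over the remaining indices, ds A + ds' A' = ds (A + A') + dr A', and both summands are
    coboundaries of invariant cochains. *)
Lemma cohomologous_cups js : exists f, [/\ f [::] = 0, invariant_cochain g f &
  forall v, size v = (size js).+1 ->
    cups (map s js) v + cups (map s' js) v = coboundary f v].
Proof.
elim: js => [|j js [f [f0 fi fE]]].
  by exists (fun=> 0); split=> // v _; rewrite /= coboundary0 F2_addrr.
pose r x := s j x + s' j x.
exists (fun v => cup (s j) f v + scale r (cups (map s' js)) v); split=> //.
- by rewrite /= addr0.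
- move=> a v; congr (_ + _); first exact: (invariant_cup (sc j)).
  case: v => //= x v; have /= -> := invariant_cups s'c js a (x :: v).
  by rewrite /r sc s'c addrACA F2_addrr addr0.
move=> v sv; rewrite coboundaryD coboundary_scale ?sv//; last first.
  by rewrite coboundary_cups// size_map.
have -> : coboundary (cup (s j) f) v = cup (s j) (coboundary f) v.
  (* On two points [coboundary_cup] does not apply; both sides vanish there because [f [::]] is
     0. *)
  case: v sv => [|x [|y [|z v]]] // sv; last exact: coboundary_cup.
  by rewrite /= f0 !addr0 mulr0.
case: v sv => [|x [|y v]] //= [sv].
rewrite -[X in _ = _ * X + _]/(coboundary f (y :: v)) -fE /= ?sv// /r.
move: (cups _ _) (cups _ _) (s j x) (s j y) (s' j x) (s' j y).
by move=> a b d e d' e'; clear; f2_cases.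
Qed.

End Cohomologous.

Section Subdivision.
Variables (P : Type) (b : P -> seq P -> P).
Implicit Types (f : seq P -> 'F_2) (v : seq P).

(* [subdivide] and [homotopy] are the transposes, on cochains, of the barycentric
   subdivision of chains and of its chain homotopy to the identity. *)
Fixpoint subdivide n f v : 'F_2 :=
  if n is n'.+1 then
    if v is x :: v' then coboundary (subdivide n' (fun u => f (b x v' :: u))) v
    else 0
  else f v.

Fixpoint homotopy n f v : 'F_2 :=
  if n is n'.+1 then
    if v is x :: v' then
      f (b x v' :: v) + coboundary (homotopy n' (fun u => f (b x v' :: u))) v
    else 0
  else 0.

Lemma subdivideS n f x v : subdivide n.+1 f (x :: v) =
  coboundary (subdivide n (fun u => f (b x v :: u))) (x :: v).
Proof. by []. Qed.

Lemma homotopyS n f x v : homotopy n.+1 f (x :: v) = f (b x v :: x :: v) +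
  coboundary (homotopy n (fun u => f (b x v :: u))) (x :: v).
Proof. by []. Qed.

Lemma eq_homotopy n f f' v :
  (forall u, size u = (size v).+1 -> f u = f' u) -> n = size v ->
  homotopy n f v = homotopy n f' v.
Proof.
elim: n f f' v => // n ih f f' [//|x v] ff' [nv].
rewrite !homotopyS ff'//; congr (_ + _); apply: eq_coboundary => u /= su.
by apply: ih => [w sw|]; rewrite ?ff' //= ?sw su.
Qed.

Lemma homotopyD n f f' v :
  homotopy n (fun u => f u + f' u) v = homotopy n f v + homotopy n f' v.
Proof.
elim: n f f' v => [|n ih] f f' [|x v]; rewrite ?addr0//.
rewrite !homotopyS [RHS]addrACA -coboundaryD; congr (_ + _).
by apply: eq_coboundary => u _; rewrite -ih.
Qed.

Lemma homotopy0 n v : homotopy n (fun=> 0) v = 0.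
Proof.
elim: n v => [|n ih] [|x v] //; rewrite homotopyS add0r.
by rewrite -[RHS](coboundary0 (x :: v)); apply: eq_coboundary => *; exact: ih.
Qed.

(** Both operators cone from the barycenter what they yield on the boundary. The coboundary of [f]
    at a cone [y :: u] is [f u] plus the coboundary at [u] of the coned cochain, to which the
    induction hypothesis applies. *)
Lemma homotopyE n f v : size v = n ->
  homotopy n (coboundary f) v + coboundary (homotopy n.-1 f) v =
  f v + subdivide n f v.
Proof.
elim: n f v => [|n ih] f [|x v] //; first by rewrite /= !F2_addrr.
move=> sv; rewrite subdivideS homotopyS.
move: sv (b x v) => /eqP; rewrite -[n.+1.-1]/n.
move: (x :: v) => {x}v /eqP sv y.
rewrite (eq_coboundary (f := homotopy n _) (g := fun u => homotopy n f u +
  (coboundary (homotopy n.-1 (fun w => f (y :: w))) u +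
   (f (y :: u) + subdivide n (fun w => f (y :: w)) u)))); last first.
  move=> u su; rewrite -ih ?su ?sv// [X in _ = _ + X]addrCA F2_addrr addr0.
  by rewrite -homotopyD.
rewrite !coboundaryD coboundaryK add0r /=.
move: (f v) (coboundary _ _) (coboundary _ _) (coboundary _ _).
by move=> a1 a2 a3 a4; clear; f2_cases.
Qed.

Lemma coboundary_subdivide n f :
  (forall v, size v = n.+1 -> coboundary f v = 0) ->
  forall v, size v = n.+1 -> coboundary (subdivide n f) v = 0.
Proof.
move=> f0 v sv.
rewrite (eq_coboundary (g := fun u => f u + coboundary (homotopy n.-1 f) u)).
  by rewrite coboundaryD f0// coboundaryK addr0.
move=> u; rewrite sv => /= su; have := homotopyE f su.
rewrite (@eq_homotopy _ _ (fun=> 0)) => [|w|//]; last by rewrite su => /f0.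
by rewrite homotopy0 add0r => ->; rewrite addrA F2_addrr add0r.
Qed.

Variables (G : Type) (g : G -> P -> P).
Hypothesis gb : forall a x v, b (g a x) (map (g a) v) = g a (b x v).

Lemma invariant_homotopy n f :
  invariant_cochain g f -> invariant_cochain g (homotopy n f).
Proof.
move=> fi a v.
(* The induction involves two cochains, since after coning one starts at [g a (b x v)] and the other
   at [b x v]. *)
suff H f1 f2 : (forall u, f1 (map (g a) u) = f2 u) ->
    homotopy n f1 (map (g a) v) = homotopy n f2 v by apply: H => u; apply: fi.
elim: n f1 f2 v {f fi} => [//|n ih] f1 f2 [//|x v] f12.
rewrite map_cons !homotopyS gb -!map_cons f12; congr (_ + _).
have fn u : homotopy n (fun u => f1 (g a (b x v) :: u)) (map (g a) u) =
    homotopy n (fun u => f2 (b x v :: u)) u.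
  by apply: ih => w; rewrite -f12.
elim: {x v}(x :: v) (homotopy _ _) (homotopy _ _) fn => //= x v IH h1 h2 h12.
rewrite h12; congr (_ + _); apply: IH => u; apply: (h12 (x :: u)).
Qed.

Lemma invariant_subdivide n f :
  invariant_cochain g f -> invariant_cochain g (subdivide n f).
Proof.
move=> fi a v.
suff H f1 f2 : (forall u, f1 (map (g a) u) = f2 u) ->
    subdivide n f1 (map (g a) v) = subdivide n f2 v by apply: H => u; apply: fi.
elim: n f1 f2 v {f fi} => [|n ih] f1 f2 v f12; first exact: f12.
case: v => [//|x v]; rewrite map_cons !subdivideS gb -map_cons.
have fn u : subdivide n (fun u => f1 (g a (b x v) :: u)) (map (g a) u) =
    subdivide n (fun u => f2 (b x v :: u)) u.
  by apply: ih => w; rewrite -f12.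
elim: {x v}(x :: v) (subdivide _ _) (subdivide _ _) fn => //= x v IH h1 h2 h12.
rewrite h12; congr (_ + _); apply: IH => u; apply: (h12 (x :: u)).
Qed.

End Subdivision.

(** * Lattice paths *)

Lemma sum_involution (T : finType) (F : T -> 'F_2) (h : T -> T) :
  involutive h -> (forall x, h x != x) -> (forall x, F (h x) = F x) ->
  \sum_x F x = 0.
Proof.
move=> hK hN Fh.
(* Of [x] and [h x] exactly one has the smaller rank, and reindexing by [h] turns one half of the
   sum into the other. *)
rewrite (bigID (fun x => (enum_rank x < enum_rank (h x))%N)) /=.
rewrite [X in _ + X](reindex_inj (inv_inj hK)) /=.
rewrite [X in _ + X](eq_bigl (fun x => (enum_rank x < enum_rank (h x))%N)).
  by under [X in _ + X]eq_bigr do rewrite Fh; rewrite F2_addrr.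
move=> x; rewrite hK -leqNgt ltn_neqAle andb_idl// => _.
by apply: contra (hN x) => /eqP /ord_inj /enum_rank_inj <-.
Qed.

Section LatticePaths.
Variables (k : nat) (P : Type) (g : 'I_k -> P -> P).

(* A state records the current lattice point and a sign for each coordinate. *)
Definition state := (multinom k * {ffun 'I_k -> bool})%type.

Definition step (st : state) (d : 'I_k * bool) : state :=
  (mnm_add st.1 (mnm1 d.1), [ffun i => if i == d.1 then d.2 else st.2 i]).

Definition flip_state (l : 'I_k) (st : state) : state :=
  (st.1, [ffun i => (i == l) (+) st.2 i]).

Variables (vertex : state -> P) (a : multinom k).
Hypothesis vertex_flip : forall l st, vertex (flip_state l st) = g l (vertex st).

(* The cochain [f] is evaluated on the chain of all lattice paths with [N] steps
   from [st] to [a]; started at [(0, +)] this is the product of the fundamental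
   cycles of the projective spaces of dimensions [a i], triangulated by shuffles. *)
Fixpoint path_sum N (st : state) (f : seq P -> 'F_2) : 'F_2 :=
  if N is N'.+1 then
    \sum_d path_sum N' (step st d) (fun v => f (vertex st :: v))
  else (st.1 == a)%:R * f [:: vertex st].

Lemma eq_path_sum N st f f' :
  (forall v, size v = N -> f (vertex st :: v) = f' (vertex st :: v)) ->
  path_sum N st f = path_sum N st f'.
Proof.
elim: N st f f' => [|N ih] st f f' ff' /=; first by rewrite ff'.
by apply: eq_bigr => d _; apply: ih => v sv; rewrite ff'//= sv.
Qed.

Lemma path_sumD N st f f' :
  path_sum N st (fun v => f v + f' v) = path_sum N st f + path_sum N st f'.
Proof.
elim: N st f f' => [|N ih] st f f' /=; first by rewrite mulrDr.
by rewrite -big_split; apply: eq_bigr => d _; rewrite ih.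
Qed.

Lemma path_sumM N st (x : 'F_2) f :
  path_sum N st (fun v => x * f v) = x * path_sum N st f.
Proof.
elim: N st f => [|N ih] st f /=; first by rewrite mulrCA.
by rewrite big_distrr; apply: eq_bigr => d _; rewrite ih.
Qed.

Lemma step_sumN (F : state -> 'F_2) st :
  (forall l s, F (step st (l, ~~ s)) = F (step st (l, s))) ->
  \sum_d F (step st d) = 0.
Proof.
move=> H; apply: (@sum_involution _ _ (fun d => (d.1, ~~ d.2))).
- by move=> [l s] /=; rewrite negbK.
- by move=> [l s]; rewrite xpair_eqE eqxx /=; case: s.
- by move=> [l s]; apply: H.
Qed.

(** Two steps in different directions can be exchanged; for two steps in the same direction the
    second overwrites the sign set by the first, which can therefore be reversed. *)
Lemma step2_sum (F : state -> 'F_2) st :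
  \sum_d \sum_e F (step (step st d) e) = 0.
Proof.
rewrite pair_big /=.
pose h (x : ('I_k * bool) * ('I_k * bool)) :=
  if x.1.1 == x.2.1 then ((x.1.1, ~~ x.1.2), x.2) else (x.2, x.1).
apply: (@sum_involution _ _ h) => -[[l s] [l' s']]; rewrite /h /=.
- by case: (eqVneq l l') => [->|ll'] /=; rewrite ?eqxx ?negbK// eq_sym (negbTE ll').
- case: (eqVneq l l') => [->|ll'] /=; rewrite !xpair_eqE; first by case: s; rewrite andbF.
  by rewrite [l' == l]eq_sym (negbTE ll').
- case: (eqVneq l l') => [->|ll'] /=; congr F; congr pair => /=.
  + by apply/ffunP => i; rewrite !ffunE /=; case: (i == l').
  + by rewrite -!addmA; congr (mnm_add _ _); rewrite addmC.
  + apply/ffunP => i; rewrite !ffunE /=; case: (eqVneq i l) => [->|//].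
    by rewrite (negbTE ll').
Qed.

(** In the boundary of the chain, deletions of interior vertices cancel by [step2_sum], and
    deletions of the last vertex cancel because the last sign is free. Only deletions of the first
    vertex remain. *)
Lemma path_sum_coboundary N st f :
  path_sum N.+1 st (coboundary f) = \sum_d path_sum N (step st d) f.
Proof.
elim: N st f => [|N ih] st f; rewrite [path_sum _.+1 _ _]/=.
  rewrite (eq_bigr (fun d => path_sum 0 (step st d) f +
      ((step st d).1 == a)%:R * f [:: vertex st])); last first.
    by move=> d _; rewrite /= addr0 mulrDr.
  rewrite big_split /= [X in _ + X](step_sumN
    (F := fun s => (s.1 == a)%:R * f [:: vertex st])) ?addr0//.
rewrite (eq_bigr (fun d => path_sum N.+1 (step st d) f +
  path_sum N.+1 (step st d) (coboundary (fun v => f (vertex st :: v)))));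
  last by move=> d _; rewrite -path_sumD.
rewrite big_split /= -[RHS]addr0; congr (_ + _).
under eq_bigr do rewrite -[\sum_d _]/(path_sum N.+1 _ (coboundary _)) ih.
exact: (step2_sum (fun s => path_sum N s (fun v => f (vertex st :: v)))).
Qed.

Lemma path_sum_flip N l st f f' : (forall v, f (map (g l) v) = f' v) ->
  path_sum N (flip_state l st) f = path_sum N st f'.
Proof.
elim: N st f f' => [|N ih] st f f' ff' /=.
  by rewrite vertex_flip -ff'.
pose h (d : 'I_k * bool) := (d.1, (d.1 == l) (+) d.2).
have hK : involutive h by move=> [i s]; rewrite /h /= addKb.
rewrite (reindex_inj (inv_inj hK)); apply: eq_bigr => d _.
have -> : step (flip_state l st) (h d) = flip_state l (step st d).
  congr pair; apply/ffunP => i; rewrite !ffunE /=.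
  by case: (eqVneq i d.1) => [->|].
by apply: ih => v; rewrite vertex_flip -ff'.
Qed.

(** After a first step [(l, true)] the paths are the translates by [g l] of those after
    [(l, false)], so an invariant cochain cancels on them: the chain is a cycle modulo the group. *)
Lemma path_sum_boundary0 N f : invariant_cochain g f -> f [::] = 0 ->
  path_sum N (mnm0, [ffun=> false]) (coboundary f) = 0.
Proof.
move=> fi f0; case: N => [|N]; first by rewrite /= f0 addr0 mulr0.
rewrite path_sum_coboundary (step_sumN (F := fun st => path_sum N st f))// => l s.
rewrite -(path_sum_flip N (l := l) _ (fi l)); congr path_sum.
congr pair; apply/ffunP => i; rewrite !ffunE /=.
by case: (eqVneq i l); case: s.
Qed.

Section Evaluation.
Variable t : 'I_k -> P -> 'F_2.
Hypothesis t_vertex : forall i st, t i (vertex st) = (st.2 i)%:R.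

(** Of the two steps in direction [l] exactly one changes the sign of coordinate [l], and it
    contributes [c l]. Summing over a step thus multiplies by the linear form of [c], with [tvar l]
    recording the direction. *)
Lemma path_sum_cups (cs : seq ('I_k -> 'F_2)) st :
  path_sum (size cs) st (cups [seq (fun x => \sum_i c i * t i x) | c <- cs]) =
  mcoeff a (mpolyX 'F_2 st.1 * \prod_(c <- cs) \sum_i c i *: tvar i).
Proof.
elim: cs st => [|c cs ih] st.
  by rewrite big_nil mulr1 mcoeffX /= mulr1.
rewrite big_cons [path_sum _ _ _]/=.
transitivity (\sum_d (\sum_i c i * (t i (vertex st) + t i (vertex (step st d)))) *
    mcoeff a (mpolyX 'F_2 (step st d).1 * \prod_(c <- cs) \sum_i c i *: tvar i)).
  apply: eq_bigr => d _; rewrite -ih -path_sumM; apply: eq_path_sum => v _ /=.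
  rewrite -big_split /=; congr (_ * _).
  by apply: eq_bigr => i _; rewrite mulrDr.
rewrite -(pair_bigA _ (fun l s => (\sum_i c i * (t i (vertex st) +
  t i (vertex (step st (l, s))))) * mcoeff a (mpolyX 'F_2 (step st (l, s)).1 *
  \prod_(c <- cs) \sum_i c i *: tvar i))) /=.
rewrite mulrA [X in mcoeff _ X]mulrAC mulr_sumr raddf_sum; apply: eq_bigr => l _ /=.
have E s : \sum_i c i * (t i (vertex st) + t i (vertex (step st (l, s)))) =
    c l * (st.2 l (+) s)%:R.
  rewrite (bigD1 l)//= !t_vertex /= !ffunE eqxx big1 => [|i il].
    by rewrite addr0; case: (st.2 l); case: s => //=; rewrite ?addr0 ?add0r ?F2_addrr.
  by rewrite !t_vertex /= !ffunE (negbTE il) F2_addrr mulr0.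
rewrite mpolyXD -/(tvar l) -scalerAr mcoeffZ mulrAC.
rewrite big_bool !E /= -mulrDl -mulrDr; congr (_ * _).
by case: (st.2 l); rewrite ?add0r ?addr0 mulr1.
Qed.

End Evaluation.
End LatticePaths.

(** * Points and barycenters *)

Lemma norm_sum_same_signs (R : realDomainType) (T : eqType) (s : seq T) (F : T -> R) :
  (forall x y, x \in s -> y \in s -> 0 <= F x * F y) ->
  `|\sum_(x <- s) F x| = \sum_(x <- s) `|F x|.
Proof.
elim: s => [|x s ih] sF; first by rewrite !big_nil normr0.
rewrite !big_cons -ih => [|y z ys zs]; last by apply: sF; rewrite inE ?ys ?zs orbT.
have : 0 <= F x * \sum_(y <- s) F y.
  rewrite mulr_sumr big_seq; apply: sumr_ge0 => y ys.
  by apply: sF; rewrite !inE ?eqxx ?ys ?orbT.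
have [x0|x0|<-] := ltgtP 0 (F x); last by rewrite normr0 !add0r.
  by rewrite pmulr_rge0// => S0; rewrite !ger0_norm ?addr_ge0// ltW.
rewrite nmulr_rge0// => S0; have xS0 : F x + \sum_(y <- s) F y <= 0.
  by rewrite -oppr_ge0 opprD addr_ge0// oppr_ge0// ltW.
by rewrite !ler0_norm ?opprD// ltW.
Qed.

Section Points.
Variables (R : realFieldType) (k n : nat).

Definition unit_rows (x : 'M[R]_(k, n.+1)) := [forall i, \sum_c `|x i c| == 1].

(* Each row of a point lies on the boundary of a cross-polytope. *)
Definition point := {x : 'M[R]_(k, n.+1) | unit_rows x}.

Implicit Types (x y : point) (u v : seq point) (i : 'I_k) (c : 'I_n.+1).

Lemma pointP x i : \sum_c `|val x i c| = 1.
Proof. by have /forallP/(_ i)/eqP := valP x. Qed.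

Definition flip_mx i0 (x : 'M[R]_(k, n.+1)) : 'M[R]_(k, n.+1) :=
  \matrix_(i, c) if i == i0 then - x i c else x i c.

Lemma unit_rows_flip i0 (x : 'M[R]_(k, n.+1)) :
  unit_rows (flip_mx i0 x) = unit_rows x.
Proof.
apply: eq_forallb => i; congr (_ == _); apply: eq_bigr => c _.
by rewrite mxE; case: ifP => // _; rewrite normrN.
Qed.

Lemma flip_subproof i0 x : unit_rows (flip_mx i0 (val x)).
Proof. by rewrite unit_rows_flip; exact: valP. Qed.

Definition flip i0 x : point := Sub (flip_mx i0 (val x)) (flip_subproof i0 x).

(** Row [i] is a signed basis vector; [inord] is faithful as long as [st.1 i <= n]. *)
Definition vertex (st : state k) : point.
Proof.
refine (@Sub _ _ point (\matrix_(i, c) ((-1) ^+ st.2 i * (c == inord (st.1 i))%:R)) _).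
apply/forallP => i; rewrite (bigD1 (inord (st.1 i)))//= big1 => [|c cp].
  by rewrite mxE eqxx mulr1 addr0 normr_sign.
by rewrite mxE (negbTE cp) mulr0 normr0.
Defined.

Lemma vertex_flip l st : vertex (flip_state l st) = flip l (vertex st).
Proof.
apply: val_inj; apply/matrixP => i c; rewrite !mxE ffunE.
by case: ifP => //= _; case: (st.2 i); rewrite !(expr0, expr1) ?mulN1r ?opprK ?mul1r.
Qed.

(** The coordinate is chosen from the support of the row alone, which flips preserve; this gives
    equivariance. The default 0 never occurs, since rows of a point are nonzero. *)
Definition row_sign i x : 'F_2 :=
  if [pick c | val x i c != 0] is Some c then (val x i c < 0)%R%:R else 0.

Lemma row_sign_flip i0 i x : row_sign i (flip i0 x) = row_sign i x + (i == i0)%:R.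
Proof.
rewrite /row_sign.
have E : (fun c => val (flip i0 x) i c != 0) =1 (fun c => val x i c != 0).
  by move=> c; rewrite mxE; case: ifP; rewrite ?oppr_eq0.
rewrite (eq_pick E); case: pickP => [c xc|x0]; last first.
  have := pointP x i; rewrite big1 => [/eqP|c _]; first by rewrite eq_sym oner_eq0.
  by move/negbFE/eqP: (x0 c) => ->; rewrite normr0.
rewrite mxE; case: (eqVneq i i0) => _; last by rewrite addr0.
by rewrite oppr_lt0; case: ltgtP xc => //=; rewrite ?F2_addrr ?add0r.
Qed.

Lemma row_sign_vertex i st : row_sign i (vertex st) = (st.2 i)%:R.
Proof.
rewrite /row_sign; case: pickP => [c|/(_ (inord (st.1 i)))].
  rewrite mxE mulf_eq0 signr_eq0 /= pnatr_eq0 eqb0 negbK => ->.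
  by rewrite mulr1; case: (st.2 i); rewrite ?ltrN10 ?expr0 ?ltr10.
by rewrite mxE eqxx mulr1 signr_eq0.
Qed.

(** The average leaves the space of points when signs disagree; [insubd] then returns [x], a default
    that still commutes with flips. *)
Definition barycenter x v : point :=
  insubd x ((size v).+1%:R^-1 *: \sum_(y <- x :: v) val y).

Lemma barycenter_flip i0 x v :
  barycenter (flip i0 x) (map (flip i0) v) = flip i0 (barycenter x v).
Proof.
rewrite /barycenter size_map.
have -> : (size v).+1%:R^-1 *: \sum_(y <- flip i0 x :: map (flip i0) v) val y =
    flip_mx i0 ((size v).+1%:R^-1 *: \sum_(y <- x :: v) val y).
  rewrite -map_cons big_map; apply/matrixP => i c; rewrite !mxE !summxE.
  case: ifP => ii0; last by congr (_ * _); apply: eq_bigr => y _; rewrite mxE ii0.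
  rewrite -mulrN -sumrN; congr (_ * _); apply: eq_bigr => y _.
  by rewrite mxE ii0.
by apply: val_inj; rewrite !val_insubd unit_rows_flip; case: ifP => h /=;
  rewrite val_insubd h.
Qed.

(* The coordinates of the points of [v] have compatible signs, i.e. [v] lies in a
   product of faces. *)
Definition same_signs v :=
  forall x y i c, x \in v -> y \in v -> 0 <= val x i c * val y i c.

(** A coordinatewise substitute for the convex hull of [v], through which compatible signs and
    bounds on coordinate differences carry over. *)
Definition in_box v y := forall i c,
  (exists2 x, x \in v & val x i c <= val y i c) /\
  (exists2 x, x \in v & val y i c <= val x i c).

Lemma in_boxT u v y : (forall x, x \in u -> in_box v x) -> in_box u y -> in_box v y.
Proof.
move=> uv uy i c; have [[x xu xy] [z zu yz]] := uy i c; split.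
  by have [[w wv wx] _] := uv x xu i c; exists w => //; apply: le_trans xy.
by have [_ [w wv wx]] := uv z zu i c; exists w => //; apply: le_trans wx.
Qed.

Lemma in_box_mem v y : y \in v -> in_box v y.
Proof. by move=> yv i c; split; exists y. Qed.

Lemma same_signs_box u v :
  same_signs v -> (forall y, y \in u -> in_box v y) -> same_signs u.
Proof.
move=> sv uv x y i c /uv/(_ i c)[[x1 x1v hx1] [x2 x2v hx2]].
move=> /uv/(_ i c)[[y1 y1v hy1] [y2 y2v hy2]].
have S := sv _ _ i c.
have [x0|x0|<-] := ltgtP 0 (val x i c); last by rewrite mul0r.
  rewrite pmulr_rge0//; have := S _ _ x2v y1v.
  by rewrite pmulr_rge0 ?(lt_le_trans x0)// => /le_trans; apply.
rewrite nmulr_rge0//; have := S _ _ x1v y2v.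
by rewrite nmulr_rge0 ?(le_lt_trans hx1 x0)// => /(le_trans hy2).
Qed.

Definition diam_le (D : R) v :=
  forall x y i c, x \in v -> y \in v -> `|val x i c - val y i c| <= D.

(** With compatible signs nothing cancels in the norms, so the average has unit rows and [insubd]
    does not use its default. *)
Lemma val_barycenter x v i c : same_signs (x :: v) ->
  val (barycenter x v) i c = (size v).+1%:R^-1 * \sum_(y <- x :: v) val y i c.
Proof.
move=> sv; rewrite val_insubd ifT; first by rewrite mxE summxE.
apply/forallP => j; apply/eqP.
rewrite (eq_bigr (fun d => (size v).+1%:R^-1 * \sum_(y <- x :: v) `|val y j d|));
  last first.
  move=> d _; rewrite mxE summxE normrM normfV normr_nat norm_sum_same_signs//.
  by move=> y z yv zv; exact: sv.
rewrite -mulr_sumr exchange_big /=.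
under eq_bigr do rewrite pointP.
rewrite big_const_seq count_predT iter_addr_0.
by rewrite -[RHS](mulVf (x := (size v).+1%:R)) ?pnatr_eq0.
Qed.

Lemma barycenter_in_box x v : same_signs (x :: v) -> in_box (x :: v) (barycenter x v).
Proof.
move=> sv i c; rewrite val_barycenter//.
have sz0 : 0 < (size v).+1%:R :> R by rewrite ltr0n.
have sumE (a : R) : \sum_(y <- x :: v) a = (size v).+1%:R * a.
  by rewrite big_const_seq count_predT iter_addr_0 mulr_natl.
set S := \sum_(y <- x :: v) _; set A := _ * S.
have AS : \sum_(y <- x :: v) A = S by rewrite sumE mulVKf ?gt_eqF.
split; apply: contrapT => H; suff: S < S by rewrite ltxx.
- rewrite -[ltLHS]AS /S big_seq [ltRHS]big_seq; apply: ltr_sum.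
    by apply/hasP; exists x; rewrite ?mem_head.
  by move=> y yv; rewrite ltNge; apply/negP => h; apply: H; exists y.
- rewrite -[ltRHS]AS /S big_seq [ltRHS]big_seq; apply: ltr_sum.
    by apply/hasP; exists x; rewrite ?mem_head.
  by move=> y yv; rewrite ltNge; apply/negP => h; apply: H; exists y.
Qed.

(** Of the [(size v).+1] differences that are averaged, the one of [y] with itself vanishes; this
    gives a factor below 1. *)
Lemma barycenter_dist D x v y i c : same_signs (x :: v) -> diam_le D (x :: v) ->
  y \in x :: v ->
  `|val (barycenter x v) i c - val y i c| <= (size v)%:R / (size v).+1%:R * D.
Proof.
move=> sv dv yv; rewrite val_barycenter//.
have sz0 : 0 < (size v).+1%:R :> R by rewrite ltr0n.
have -> : (size v).+1%:R^-1 * (\sum_(z <- x :: v) val z i c) - val y i c =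
    (size v).+1%:R^-1 * \sum_(z <- x :: v) (val z i c - val y i c).
  rewrite sumrB big_const_seq count_predT iter_addr_0 mulrBr; congr (_ - _).
  by rewrite -[_ *+ size _]mulr_natl mulKf ?gt_eqF.
rewrite normrM gtr0_norm ?invr_gt0// mulrAC mulrC ler_pM2r ?invr_gt0//.
have rs : size (rem y (x :: v)) = size v by rewrite size_rem.
have rv : {subset rem y (x :: v) <= x :: v} by move=> z /mem_rem.
have -> : \sum_(z <- x :: v) (val z i c - val y i c) =
    \sum_(z <- rem y (x :: v)) (val z i c - val y i c).
  by rewrite [LHS](big_rem y)//= subrr add0r.
move: (rem y _) rs rv => w <- wv.
apply: (le_trans (ler_norm_sum _ _ _)).
have -> : (size w)%:R * D = \sum_(z <- w) D.
  by rewrite big_const_seq count_predT iter_addr_0 mulr_natl.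
rewrite big_seq [leRHS]big_seq; apply: ler_sum => z /wv zv.
exact: dv.
Qed.

End Points.

(** * Small alternating simplices *)

Lemma coboundary_neq0 (P : eqType) (f : seq P -> 'F_2) v : coboundary f v != 0 ->
  exists u, [/\ size u = (size v).-1, {subset u <= v} & f u != 0].
Proof.
elim: v f => [|x v ih] f //=.
have [fv0|fv] := eqVneq (f v) 0; last first.
  by exists v; split=> // y yv; rewrite inE yv orbT.
rewrite fv0 add0r => H; have vn : v != [::] by case: v H {fv0 ih} => [/eqP|].
have [u [su uv fu]] := ih _ H; exists (x :: u); split=> //=.
  by rewrite su; case: v vn {H fv0 ih uv su}.
by move=> y; rewrite !inE => /orP[->//|/uv ->]; rewrite orbT.
Qed.

Section SmallSimplices.
Variables (R : realFieldType) (k n : nat).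
Local Notation point := (point R k n).
Implicit Types (u v : seq point).

(** A nonzero value comes from a simplex made of the barycenter and, recursively, a simplex inside a
    face. [N] bounds every dimension met, so that one contraction factor serves throughout. *)
Lemma subdivide_neq0 N m f v (D : R) :
  size v = m -> (m <= N.+1)%N -> 0 <= D -> same_signs v -> diam_le D v ->
  subdivide (@barycenter R k n) m f v != 0 ->
  exists u, [/\ size u = m, f u != 0, forall y, y \in u -> in_box v y &
    diam_le (N%:R / N.+1%:R * D) u].
Proof.
move=> + + D0; elim: m f v => [|m ih] f v sv mN ss dv.
  by move=> fv; case: v sv {ss dv} fv => // _ f0; exists [::]; split.
case: v sv ss dv => // x v sv ss dv; rewrite subdivideS.
move=> /coboundary_neq0[w [sw wv fw]].
have {}sw : size w = m by rewrite sw sv.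
have [|||u [su fu uw du]] := ih _ w sw _ _ _ fw.
- exact: ltnW.
- by move=> y z i c /wv yv /wv zv; exact: ss.
- by move=> y z i c /wv yv /wv zv; exact: dv.
have uv y : y \in barycenter x v :: u -> in_box (x :: v) y.
  rewrite inE => /orP[/eqP ->|/uw]; first exact: barycenter_in_box.
  by apply: in_boxT => z /wv; exact: in_box_mem.
have bu y i c : y \in barycenter x v :: u ->
    `|val (barycenter x v) i c - val y i c| <= N%:R / N.+1%:R * D.
  move=> /uv/(_ i c)[[y1 y1v hy1] [y2 y2v hy2]].
  have vN : (size v)%:R / (size v).+1%:R * D <= N%:R / N.+1%:R * D.
    rewrite ler_wpM2r// ler_pdivrMr ?ltr0n// mulrAC ler_pdivlMr ?ltr0n//.
    by rewrite -!natrM ler_nat !mulnS [(N * _)%N]mulnC leq_add2r; move: mN; rewrite -sv.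
  have H z : z \in x :: v -> `|val (barycenter x v) i c - val z i c| <= _ :=
    fun zv => le_trans (barycenter_dist i c ss dv zv) vN.
  rewrite ler_norml; apply/andP; split.
    have := H _ y2v; rewrite ler_norml => /andP[h _].
    by apply: (le_trans h); rewrite lerD2l lerN2.
  have := H _ y1v; rewrite ler_norml => /andP[_ h].
  by apply: le_trans h; rewrite lerD2l lerN2.
exists (barycenter x v :: u); split=> //; first by rewrite /= su.
move=> y z i c; rewrite inE => /orP[/eqP ->|yu]; first exact: bu.
rewrite inE => /orP[/eqP ->|zu]; last exact: du.
by rewrite distrC; apply: bu; rewrite inE yu orbT.
Qed.

Lemma iter_subdivide_neq0 N M f v (D : R) :
  size v = N.+1 -> 0 <= D -> same_signs v -> diam_le D v ->
  iter M (subdivide (@barycenter R k n) N.+1) f v != 0 ->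
  exists u, [/\ size u = N.+1, f u != 0 & diam_le ((N%:R / N.+1%:R) ^+ M * D) u].
Proof.
move=> + + + + ; elim: M v D => [|M ih] v D sv D0 ss dv.
  by move=> fv; exists v; split=> //; rewrite expr0 mul1r.
rewrite iterS => /(subdivide_neq0 sv (leqnn _) D0 ss dv)[w [sw fw wv dw]].
have [||u [su fu du]] := ih w _ sw _ _ dw fw.
- by rewrite mulr_ge0// divr_ge0.
- exact: same_signs_box wv.
by exists u; split=> //; rewrite exprSr -mulrA.
Qed.

Variable a : multinom k.
Hypothesis an : forall i, (a i <= n)%N.

(** Along a path the index of a row never decreases, and its sign changes only when the index grows.
    Equal indices thus carry equal signs, which gives [same_signs]; [an] makes [inord] injective on
    the indices. *)
Lemma path_sum_neq0 N st f : path_sum (@vertex R k n) a N st f != 0 ->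
  exists v, [/\ size v = N.+1, f v != 0, same_signs v &
    forall x, x \in v -> forall i, exists (b : bool) q,
      [/\ (st.1 i <= q <= a i)%N, q = st.1 i -> b = st.2 i &
       forall c, val x i c = (-1) ^+ b * (c == inord q)%:R]].
Proof.
have vst (st' : state k) : (forall i, st'.1 i <= a i)%N -> forall i, exists (b : bool) q,
      [/\ (st'.1 i <= q <= a i)%N, q = st'.1 i -> b = st'.2 i &
       forall c, val (@vertex R k n st') i c = (-1) ^+ b * (c == inord q)%:R].
  move=> h i; exists (st'.2 i), (st'.1 i); split=> //; first by rewrite leqnn h.
  by move=> c; rewrite mxE.
elim: N st f => [|N ih] st f /=.
  have [sta|] := eqVneq st.1 a; last by rewrite mul0r eqxx.
  rewrite mul1r => fv; exists [:: vertex R n st]; split=> //.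
    by move=> x y i c; rewrite !inE => /eqP -> /eqP ->; rewrite -expr2 sqr_ge0.
  by move=> x; rewrite inE => /eqP -> i; apply: vst => j; rewrite sta.
move=> H; have [d] : exists d, path_sum (@vertex R k n) a N (step st d)
    (fun v => f (vertex R n st :: v)) != 0.
  apply: contrapT => h; move/negP: H; apply; apply/eqP; apply: big1 => d _.
  by apply/eqP/negPn/negP => h'; apply: h; exists d.
move=> /ih[v [sv fv ss vst']].
have {}vst' x : x \in v -> forall i, exists (b : bool) q,
    [/\ (st.1 i <= q <= a i)%N, q = st.1 i -> b = st.2 i &
     forall c, val x i c = (-1) ^+ b * (c == inord q)%:R].
  move=> /vst' + i => /(_ i)[b [q [/andP[q1 q2] qb xq]]]; exists b, q; split=> //.
    by rewrite q2 andbT (leq_trans _ q1)//= mnmDE leq_addr.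
  move=> qst; move: q1 qb; rewrite /= mnmDE mnm1E ffunE qst.
  by case: (eqVneq d.1 i) => [|_ _]; rewrite ?addn1 ?ltnn// addn0 => ->.
have sta i : (st.1 i <= a i)%N.
  case: v sv vst' {fv ss} => // x v _ /(_ x); rewrite mem_head => /(_ isT i).
  by move=> [b [q [/andP[h1 h2] _ _]]]; apply: leq_trans h2.
exists (vertex R n st :: v); split=> //=; first by rewrite sv.
  have S y i c : y \in v -> 0 <= val (vertex R n st) i c * val y i c.
    move=> /vst'/(_ i)[b [q [/andP[h1 h2] qb ->]]]; rewrite mxE.
    have [->|cq] := eqVneq c (inord q); last by rewrite !mulr0.
    rewrite mulr1; have [E|] := eqVneq (inord q : 'I_n.+1) (inord (st.1 i)).
      rewrite qb ?mulr1 -?expr2 ?sqr_ge0//.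
      move/(congr1 (@nat_of_ord _)): E; rewrite !inordK//.
        by rewrite ltnS (leq_trans (sta i))// an.
      by rewrite ltnS (leq_trans h2)// an.
    by rewrite mulr0 mul0r.
  move=> x y i c; rewrite !inE => /orP[/eqP ->|xv] /orP[/eqP ->|yv].
  - by rewrite -expr2 sqr_ge0.
  - exact: S.
  - by rewrite mulrC; exact: S.
  - exact: ss.
move=> x; rewrite inE => /orP[/eqP ->|/vst' //]; exact: vst.
Qed.

Theorem small_alternating_simplices (J : Type) (js : seq J) (c : J -> 'I_k -> 'F_2)
    (s : J -> point -> 'F_2) :
  (forall j, equivariant (@flip R k n) (c j) (s j)) ->
  mcoeff a (\prod_(j <- js) \sum_i c j i *: tvar i) != 0 ->
  forall M, exists u, [/\ size u = (size js).+1, cups (map s js) u != 0 &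
    diam_le (((size js)%:R / (size js).+1%:R) ^+ M * 2) u].
Proof.
move=> sc ca M; set N := size js.
pose st0 : state k := (mnm0, [ffun=> false]).
pose S := path_sum (@vertex R k n) a N st0.
(* Model functions with the characters of the [s j], for which [path_sum_cups] evaluates the cochain
   to the coefficient in [ca]. *)
pose t j (x : point) := \sum_i c j i * row_sign i x.
have tc j : equivariant (@flip R k n) (c j) (t j).
  move=> i0 x; rewrite /t (eq_bigr (fun i => c j i * row_sign i x +
      c j i * (i == i0)%:R)); last by move=> i _; rewrite row_sign_flip mulrDr.
  rewrite big_split /= [X in _ + X](bigD1 i0)//= eqxx mulr1.
  by rewrite [X in _ + (_ + X)]big1 ?addr0// => i /negbTE ->; rewrite mulr0.
have St : S (cups (map t js)) != 0.
  have := path_sum_cups a (@row_sign_vertex R k n) (map c js) st0.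
  rewrite size_map -map_comp -/N big_map mpolyX0 mul1r => E.
  by rewrite -E in ca.
pose B0 := path_sum_boundary0 (g := @flip R k n) a (@vertex_flip R k n).
have Ss : S (cups (map s js)) != 0.
  have [f [f0 fi fE]] := cohomologous_cups sc tc js.
  suff -> : S (cups (map s js)) = S (cups (map t js)) by [].
  apply: F2_addr0; rewrite -path_sumD -(B0 N f fi f0).
  by apply: eq_path_sum => v sv; rewrite fE//= sv.
pose sd M := iter M (subdivide (@barycenter R k n) N.+1) (cups (map s js)).
have sdP : [/\ invariant_cochain (@flip R k n) (sd M),
    forall v, size v = N.+2 -> coboundary (sd M) v = 0 & S (sd M) != 0].
  elim: M => [|M [Hi Hc HS]].
    split=> //; first exact: invariant_cups sc _.
    by move=> v sv; rewrite coboundary_cups// size_map.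
  rewrite /sd iterS -/(sd M); split.
  - by apply: invariant_subdivide => // *; exact: barycenter_flip.
  - exact: coboundary_subdivide.
  (* As [sd M] is a cocycle, [homotopyE] makes the difference the coboundary of an invariant
     cochain, on which the chain vanishes. *)
  suff -> : S (subdivide (@barycenter R k n) N.+1 (sd M)) = S (sd M) by [].
  apply: F2_addr0; rewrite -path_sumD.
  have hi : invariant_cochain (@flip R k n)
      (homotopy (@barycenter R k n) N (sd M)).
    by apply: invariant_homotopy => // *; exact: barycenter_flip.
  rewrite -(B0 N _ hi); last by case: (N).
  apply: eq_path_sum => v sv; have sv' : size (vertex R n st0 :: v) = N.+1.
    by rewrite /= sv.
  rewrite addrC -(homotopyE _ _ sv') -[RHS]add0r; congr (_ + _).
  rewrite (@eq_homotopy _ _ _ _ (fun=> 0)) ?sv'//; exact: homotopy0.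
have [_ _ /path_sum_neq0[v [sv fv ss vst]]] := sdP.
(* Entries of a point lie in [-1, 1], hence the initial diameter 2. *)
apply: (@iter_subdivide_neq0 N M _ v 2) => // x y i d xv yv.
rewrite (le_trans (ler_normB _ _))// -[leRHS]/(1 + 1).
suff H (z : point) : `|val z i d| <= 1 by rewrite lerD ?H.
by rewrite -(pointP z i) (bigD1 d)//= lerDl sumr_ge0.
Qed.

End SmallSimplices.

(** * Common zeros of equivariant functions *)

Section Subsequences.
Import numFieldNormedType.Exports.
Local Open Scope classical_set_scope.

Lemma increasing_seq_cvgny (f : nat -> nat) : increasing_seq f -> f @ \oo --> \oo.
Proof.
move=> fi A [m _ mA]; exists m => // q /= mq; apply: mA => /=.
apply: leq_trans mq _; elim: q => // q; rewrite -ltnS => /leq_trans; apply.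
by move/increasing_seqP : fi; exact.
Qed.

Lemma bolzano_weierstrass_seq (R : realType) (I : eqType) (s : seq I)
    (u : I -> nat -> R) : (forall t q, `|u t q| <= 1) ->
  exists2 f : nat -> nat, increasing_seq f & {in s, forall t, cvgn (u t \o f)}.
Proof.
move=> u1; elim: s => [|t s [f fi fs]]; first by exists id.
have [|g gi gt] := @bolzano_weierstrass R (u t \o f).
  by exists 1; split=> // M M1 q /= _; apply: le_trans (ltW M1).
exists (f \o g); first by move=> p q; exact: etrans (fi _ _) (gi _ _).
move=> t'; rewrite inE => /orP[/eqP -> //|/fs /cvg_ex[l ul]].
apply/cvg_ex; exists l; rewrite compA.
exact: cvg_comp (increasing_seq_cvgny gi) ul.
Qed.

End Subsequences.

Lemma cups_neq0 (P : eqType) (J : eqType) (s : J -> P -> 'F_2) (js : seq J) u :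
  size u = (size js).+1 -> cups (map s js) u != 0 ->
  {in js, forall j, exists x y, [/\ x \in u, y \in u & s j x != s j y]}.
Proof.
elim: js u => // j js ih [//|x [//|y u]] [su] /=.
rewrite mulf_eq0 negb_or => /andP[sxy cu] j'; rewrite inE => /orP[/eqP ->|].
  exists x, y; rewrite !inE !eqxx orbT; split=> //.
  by apply: contraNneq sxy => ->; rewrite F2_addrr.
move=> /(ih (y :: u) _ cu)[|x' [y' [xu yu sx]]]; first by rewrite /= su.
by exists x', y'; rewrite !(in_cons x) xu yu !orbT.
Qed.

Section CommonZero.
Import numFieldNormedType.Exports.
Local Open Scope classical_set_scope.
Variables (R : realType) (k n : nat) (J : eqType) (js : seq J).
Variables (c : J -> 'I_k -> bool) (F : J -> 'M[R]_(k, n.+1) -> R).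

Hypothesis F_flip : forall j i x, unit_rows x ->
  F j (flip_mx i x) = if c j i then - F j x else F j x.

Hypothesis F_continuous : forall j (y : nat -> 'M[R]_(k, n.+1)) x,
  (forall q, unit_rows (y q)) -> unit_rows x ->
  (forall i d, (fun q => y q i d) @ \oo --> x i d) ->
  (fun q => F j (y q)) @ \oo --> F j x.

Theorem common_zero (a : multinom k) : (forall i, a i <= n)%N ->
  mcoeff a (\prod_(j <- js) \sum_i (c j i)%:R *: tvar i : polyA k) != 0 ->
  exists2 x, unit_rows x & {in js, forall j, F j x = 0}.
Proof.
move=> an ca.
(* At the zeros of [F j] the row signs supply a value with the same character, so that [s j] is
   equivariant everywhere. *)
pose s j (x : point R k n) : 'F_2 :=
  if F j (val x) == 0 then \sum_i (c j i)%:R * row_sign i x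
  else (F j (val x) < 0)%R%:R.
have sc j : equivariant (@flip R k n) (fun i => (c j i)%:R) (s j).
  move=> i x; rewrite /s F_flip ?valP//.
  case: ifP => [/eqP Fx|Fx].
    have -> : F j (val x) = 0 by case: ifP Fx => _ // /eqP; rewrite oppr_eq0 => /eqP.
    rewrite eqxx; under eq_bigr do rewrite row_sign_flip mulrDr.
    rewrite big_split /= [X in _ + X](bigD1 i)//= eqxx mulr1.
    by rewrite [X in _ + (_ + X)]big1 ?addr0// => l /negbTE ->; rewrite mulr0.
  have {}Fx : F j (val x) != 0 by case: ifP Fx => _ /negbT; rewrite ?oppr_eq0.
  rewrite (negbTE Fx); case: (c j i); last by rewrite addr0.
  by rewrite oppr_lt0; case: ltgtP Fx => //= _ _; rewrite ?F2_addrr ?add0r.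
have sF j x y : s j x != s j y -> F j (val x) * F j (val y) <= 0.
  rewrite /s; have [->|x0] := eqVneq (F j (val x)); first by rewrite mul0r.
  have [->|y0] := eqVneq (F j (val y)); first by rewrite mulr0.
  have [Fx|Fx|] := ltgtP (F j (val x)) 0; last by move/eqP: x0.
    have [Fy|Fy|] := ltgtP (F j (val y)) 0; last by move/eqP: y0.
      by rewrite eqxx.
    by rewrite nmulr_rle0// ltW.
  have [Fy|Fy|] := ltgtP (F j (val y)) 0; last by move/eqP: y0.
    by rewrite pmulr_rle0// ltW.
  by rewrite eqxx.
have [u uP] := choice (small_alternating_simplices an sc ca).
have u0 M : exists y : point R k n, y \in u M.
  by have [] := uP M; case: (u M) => // y v _ _ _; exists y; rewrite mem_head.
have [x xu] := choice u0.
have x1 i d M : `|val (x M) i d| <= 1.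
  by rewrite -(pointP (x M) i) (bigD1 d)//= lerDl sumr_ge0.
have [f fi fc] := bolzano_weierstrass_seq (enum {: 'I_k * 'I_n.+1})
  (fun t M => x1 t.1 t.2 M).
pose z : 'M[R]_(k, n.+1) := \matrix_(i, d) lim ((fun M => val (x M) i d) \o f @ \oo).
have xz i d : (fun M => val (x (f M)) i d) @ \oo --> z i d.
  by rewrite mxE; apply: (fc (i, d)); rewrite mem_enum.
have z1 : unit_rows z.
  apply/forallP => i; apply/eqP.
  have H : (fun M => \sum_d `|val (x (f M)) i d|) @ \oo --> \sum_d `|z i d|.
    apply: cvg_big => [|d _]; first exact: add_continuous.
    by apply: cvg_norm; exact: xz.
  rewrite (_ : (fun M => _) = cst 1) in H; last first.
    by apply/funext => M; exact: pointP.
  by rewrite -(cvg_lim _ H)//; apply: lim_cst.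
exists z => // j jjs.
pose r : R := (size js)%:R / (size js).+1%:R.
(* Diameters tend to 0, so any choice of one vertex in each simplex has the same limit [z]. *)
have yz (y : nat -> point R k n) : (forall M, y M \in u M) ->
    forall i d, (fun M => val (y (f M)) i d) @ \oo --> z i d.
  move=> yu i d; rewrite -[z i d]add0r.
  rewrite (_ : (fun M => _) = (fun M => (val (y (f M)) i d - val (x (f M)) i d) +
    val (x (f M)) i d)); last by apply/funext => M; rewrite subrK.
  apply: cvgD; last exact: xz.
  apply/norm_cvg0P; apply: (@squeeze_cvgr _ _ _ _ (cst 0) (fun M => r ^+ f M * 2)).
  - apply: nearW => M; rewrite normr_ge0 /=.
    by have [_ _ du] := uP (f M); apply: du.
  - exact: cvg_cst.
  - rewrite -[X in _ --> X](mul0r 2); apply: cvgMl.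
    apply: cvg_comp (increasing_seq_cvgny fi) _; apply: cvg_expr.
    rewrite ger0_norm ?divr_ge0// ltr_pdivrMr ?ltr0n// mul1r ltr_nat//.
have H M : exists yw : point R k n * point R k n,
    [/\ yw.1 \in u M, yw.2 \in u M & s j yw.1 != s j yw.2].
  have [su cu _] := uP M; have [y [w [yu wu sy]]] := cups_neq0 su cu jjs.
  by exists (y, w).
have [yw ywP] := choice H.
have Fy := @F_continuous j (fun q => val (yw (f q)).1) z
  (fun q => valP (yw (f q)).1) z1
  (yz (fun M => (yw M).1) (fun M => let: And3 h _ _ := ywP M in h)).
have Fw := @F_continuous j (fun q => val (yw (f q)).2) z
  (fun q => valP (yw (f q)).2) z1
  (yz (fun M => (yw M).2) (fun M => let: And3 _ h _ := ywP M in h)).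
have Fyw : (fun q => F j (val (yw (f q)).1) * F j (val (yw (f q)).2)) @ \oo -->
    F j z * F j z by exact: cvgM Fy Fw.
(* Two vertices with different values of [s j] make the product nonpositive, and in the limit it
   becomes a square. *)
have : F j z * F j z <= 0.
  rewrite -(cvg_lim _ Fyw)//; apply: limr_le.
    by apply/cvg_ex; eexists; exact: Fyw.
  by apply: nearW => q; apply: sF; have [] := ywP (f q).
rewrite -expr2 => h; apply/eqP; rewrite -sqrf_eq0 eq_le h sqr_ge0 //.
Qed.

End CommonZero.

(** * Measures *)

Section Measure.
Variable R : realType.
Import numFieldNormedType.Exports.
Local Open Scope classical_set_scope.

Lemma measurable_linear n (v : 'I_n -> R) (b : R) :
  measurable_fun [set: Rn R n] (fun y => \sum_i tnth y i * v i - b : R).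
Proof.
apply: measurable_funB; last exact: measurable_cst.
apply: measurable_sum => i; apply: measurable_funM; last exact: measurable_cst.
exact: measurable_tnth.
Qed.

Lemma measurable_hyperplane n (v : 'I_n -> R) (b : R) :
  measurable [set y : Rn R n | \sum_i tnth y i * v i = b :> R].
Proof.
have := measurable_linear v b measurableT (measurable_set1 0); rewrite setTI.
rewrite (_ : _ @^-1` _ = [set y : Rn R n | \sum_i tnth y i * v i = b :> R])//.
apply/seteqP; split=> y /= /eqP; first by rewrite subr_eq0 => /eqP.
by move=> /eqP ->; rewrite subrr.
Qed.

(** If the normal has a nonzero coordinate after the first, every section at a fixed first
    coordinate is a hyperplane of lower dimension; otherwise the set is a point times the whole
    space. *)
Lemma lebesgueRn_hyperplane n (v : 'I_n -> R) (b : R) : (exists i, v i != 0) ->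
  lebesgueRn [set y : Rn R n | \sum_i tnth y i * v i = b :> R] = 0%E.
Proof.
elim: n v b => [|n ih] v b [i vi]; first by case: i vi.
have [nu nuE] := lebesgueRn_sigma_finite R n.
rewrite /= -nuE /pushforward.
have E (x : R) (t : Rn R n) : \sum_i tnth (tcons (x, t)) i * v i =
    x * v ord0 + \sum_i tnth t i * v (lift ord0 i).
  by rewrite big_ord_recl; congr (_ + _); apply: eq_bigr => j _; rewrite tnthS.
have [[j vj]|H] := pselect (exists j, v (lift ord0 j) != 0).
  rewrite /product_measure1 -[RHS](integral0 lebesgue_measure setT).
  apply: eq_integral => x _ /=; rewrite nuE -[RHS](ih (fun j => v (lift ord0 j))
    (b - x * v ord0)); last by exists j.
  congr (lebesgueRn _); apply/seteqP; split=> t; rewrite xsectionE /= E.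
    by move=> <-; rewrite addrC addKr.
  by move=> ->; rewrite subrKC.
have v0 : v ord0 != 0.
  by case: (unliftP ord0 i) vi => [j ->|-> //] vj; case: H; exists j.
rewrite (_ : _ @^-1` _ = [set b / v ord0] `*` setT); last first.
  apply/seteqP; split=> -[x t] /=; rewrite E big1 ?addr0.
  - by move=> <-; rewrite mulfK.
  - move=> j _; have [->|h] := eqVneq (v (lift ord0 j)) 0; first by rewrite mulr0.
    by case: H; exists j.
  - by move=> [-> _]; rewrite divfK.
  - move=> j _; have [->|h] := eqVneq (v (lift ord0 j)) 0; first by rewrite mulr0.
    by case: H; exists j.
rewrite product_measure1E//= [X in (X * _)%E](_ : _ = 0%E) ?mul0e//.
exact: lebesgue_measure_set1.
Qed.

End Measure.

(** * Signs of affine forms and the means of their products *)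

Section Parity.
Variables (R : realType) (k n : nat).
Import numFieldNormedType.Exports.
Local Open Scope classical_set_scope.
Implicit Types (x : 'M[R]_(k, n.+1)) (S : {set 'I_k}) (y : Rn R n).

(* Row [i] of [x] is (offset, normal). *)
Definition side x i y : R := \sum_c tnth y c * x i (lift ord0 c) - x i ord0.

Definition parity x S y : R := \prod_(i in S) Num.sg (side x i y).

Lemma measurable_side x i : measurable_fun setT (side x i).
Proof. exact: measurable_linear. Qed.

Lemma measurable_sg : measurable_fun [set: R] (@Num.sg R).
Proof.
rewrite (_ : Num.sg = (fun r : R => if r == 0 then 0 else if r < 0 then -1 else 1))//.
apply: measurable_fun_ifT => //; first exact: measurable_fun_eqr.
by apply: measurable_fun_ifT => //; exact: measurable_fun_ltr.
Qed.

Lemma measurable_parity x S : measurable_fun setT (parity x S).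
Proof.
rewrite (_ : parity x S = fun y => \prod_(i <- enum S) Num.sg (side x i y)).
  apply: measurable_prod => i _; apply: measurableT_comp; first exact: measurable_sg.
  exact: measurable_side.
by apply/funext => y; rewrite /parity big_enum.
Qed.

Lemma parity_le1 x S y : `|parity x S y| <= 1.
Proof.
rewrite normr_prod; apply: prodr_ile1 => i _; rewrite normr_ge0 normr_sg.
by rewrite lern1 leq_b1.
Qed.

Lemma side_flip i0 x i y : side (flip_mx i0 x) i y =
  if i == i0 then - side x i y else side x i y.
Proof.
rewrite /side mxE; case: ifP => ii0; last first.
  by congr (_ - _); apply: eq_bigr => c _; rewrite mxE ii0.
rewrite opprB opprK addrC; congr (_ + _); rewrite -sumrN.
by apply: eq_bigr => c _; rewrite mxE ii0 mulrN.
Qed.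

Lemma parity_flip i0 x S y : parity (flip_mx i0 x) S y =
  if i0 \in S then - parity x S y else parity x S y.
Proof.
rewrite /parity; case: ifP => i0S; last first.
  apply: eq_bigr => i iS; rewrite side_flip; case: eqVneq => // ii0.
  by rewrite -ii0 iS in i0S.
rewrite (bigD1 i0)//= [in RHS](bigD1 i0)//= side_flip eqxx sgrN mulNr.
by congr (- (_ * _)); apply: eq_bigr => i /andP[_ /negbTE ii0]; rewrite side_flip ii0.
Qed.

(** A unit row with zero normal has nonzero offset, so its affine form is a nonzero constant. *)
Lemma side_affine x y i : unit_rows x -> (forall c, x i (lift ord0 c) = 0) ->
  side x i y != 0.
Proof.
move=> /forallP/(_ i) x1 xi0; rewrite /side big1 => [|c _]; last by rewrite xi0 mulr0.
rewrite sub0r oppr_eq0; apply: contraTneq x1 => x0.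
rewrite big1 ?(eq_sym 0) ?oner_eq0// => c _.
by case: (unliftP ord0 c) => [d ->|->]; rewrite ?xi0 ?x0 normr0.
Qed.

Variable mu : probability (Rn R n) R.
Hypothesis mu_ac : mu `<< @lebesgueRn R n.

Lemma mu_hyperplane x i : unit_rows x -> mu [set y | side x i y = 0] = 0%E.
Proof.
move=> x1; have [[c xc]|H] := pselect (exists c, x i (lift ord0 c) != 0); last first.
  have xi0 c : x i (lift ord0 c) = 0.
    by apply/eqP; apply: contrapT => /negP h; apply: H; exists c.
  rewrite (_ : mkset _ = set0) ?measure0//; apply/seteqP; split=> y //= s0.
  by have := side_affine y x1 xi0; rewrite s0 eqxx.
have E : [set y | side x i y = 0] =
    [set y : Rn R n | \sum_c tnth y c * x i (lift ord0 c) = x i ord0 :> R].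
  apply/seteqP; split=> y /=; rewrite /side; last by move=> ->; rewrite subrr.
  by move/eqP; rewrite subr_eq0 => /eqP.
have mE : measurable [set y | side x i y = 0].
  by rewrite E; exact: measurable_hyperplane.
suff H : (@lebesgueRn R n).-null_set [set y | side x i y = 0].
  exact: (mu_ac H mE).
move=> A mA AE; have [nu nuE] := lebesgueRn_sigma_finite R n.
rewrite -nuE; apply/eqP; rewrite -measure_le0.
have <- : nu [set y | side x i y = 0] = 0%E.
  by rewrite nuE E; apply: lebesgueRn_hyperplane; exists c.
by apply: le_measure; rewrite ?inE.
Qed.

Lemma ae_side_neq0 x : unit_rows x -> {ae mu, forall y, forall i, side x i y != 0}.
Proof.
move=> x1; apply: filter_forall => i.
exists [set y | side x i y = 0]; split; last 2 first.
- exact: mu_hyperplane.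
- by move=> y /= /negP/negPn/eqP.
by have := measurable_side x i measurableT (measurable_set1 0); rewrite setTI.
Qed.

Lemma integrable_parity x S : mu.-integrable setT (EFin \o parity x S).
Proof.
apply: measurable_bounded_integrable => //.
- by rewrite (le_lt_trans (probability_le1 _ _))// ltry.
- exact: measurable_parity.
- by exists 1; split=> // M M1 y /= _; apply: le_trans (ltW M1); exact: parity_le1.
Qed.

Definition mean_parity S x : R := (\int[mu]_y parity x S y)%R.

Lemma mean_parity_flip i0 x S : mean_parity S (flip_mx i0 x) =
  if i0 \in S then - mean_parity S x else mean_parity S x.
Proof.
rewrite /mean_parity (@eq_Rintegral _ _ _ _ _ (fun y =>
  (if i0 \in S then -1 else 1) * parity x S y)).
  by rewrite RintegralZl//; [case: ifP; rewrite ?mulN1r ?mul1r|exact: integrable_parity].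
by move=> y _; rewrite parity_flip; case: ifP; rewrite ?mulN1r ?mul1r.
Qed.

(** Dominated convergence: almost every point avoids the limit hyperplanes, and there the signs are
    eventually constant. *)
Lemma mean_parity_continuous S (u : nat -> 'M[R]_(k, n.+1)) x : unit_rows x ->
  (forall i d, (fun q => u q i d) @ \oo --> x i d) ->
  (fun q => mean_parity S (u q)) @ \oo --> mean_parity S x.
Proof.
move=> x1 ux.
have [|||||ix _ H] := @dominated_convergence _ _ _ mu setT measurableT
  (fun q => EFin \o parity (u q) S) (EFin \o parity x S) (cst 1%:E).
- by move=> q; apply/measurable_EFinP; exact: measurable_parity.
- by apply/measurable_EFinP; exact: measurable_parity.
- apply: filterS (ae_side_neq0 x1) => y y0 _.
  apply: cvg_EFin; first exact: nearW.
  rewrite /parity; apply: cvg_big => [|i _]; first exact: mul_continuous.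
  have su : (fun q => side (u q) i y) @ \oo --> side x i y.
    apply: cvgB; last exact: ux.
    apply: cvg_big => [|c _]; first exact: add_continuous.
    by apply: cvgMr; exact: ux.
  apply: cvg_near_cst.
  have [xi|xi|] := ltgtP (side x i y) 0; last by move/eqP: (y0 i).
    have : \forall q \near \oo, side (u q) i y < 0 by apply: (cvgr_lt (side x i y)).
    by apply: filterS => q qi; rewrite !ltr0_sg.
  have : \forall q \near \oo, 0 < side (u q) i y by apply: (cvgr_gt (side x i y)).
  by apply: filterS => q qi; rewrite !gtr0_sg.
- exact: finite_measure_integrable_cst.
- by apply: nearW => y q _; rewrite lee_fin; exact: parity_le1.
apply: fine_cvg; rewrite fineK; last exact: integrable_fin_num.
exact: H.
Qed.

End Parity.

Section Equipartition.
Variables (R : realType) (k n : nat).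
Import numFieldNormedType.Exports.
Local Open Scope classical_set_scope.

Variable mu : probability (Rn R n) R.
Hypothesis mu_ac : mu `<< @lebesgueRn R n.
Variable x : 'M[R]_(k, n.+1).
Hypothesis x1 : unit_rows x.

Lemma integral_parity S :
  mean_parity mu S x = 0 -> (\int[mu]_y (parity x S y)%:E = 0)%E.
Proof.
move=> S0; rewrite -[LHS]fineK; last first.
  by apply: integrable_fin_num => //; exact: integrable_parity.
by rewrite -/(Rintegral mu setT (parity x S)) -/(mean_parity mu S x) S0.
Qed.

Lemma parity0 y : parity x finset.set0 y = 1.
Proof. by rewrite /parity big_set0. Qed.

(** Almost everywhere the indicator of an orthant is the product of the (1 + e_j sg(side_j)) / 2. On
    expanding and integrating, only the empty subset survives, with value [2 ^- l]. *)
Lemma equiparts_mean_parity l (f : 'I_l -> 'I_k) (H : 'I_l -> hyperplane R n) :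
  injective f ->
  (forall j y, dot y (normal (H j)) - offset (H j) = side x (f j) y) ->
  (forall S : {set 'I_k}, (0 < #|S| <= l)%N -> mean_parity mu S x = 0) ->
  equiparts H mu.
Proof.
move=> fI Hx xS a; rewrite probability_setT mule1.
pose e j : R := if a j then 1 else -1.
have HE j : halfspace (H j) (a j) = [set y | 0 < e j * side x (f j) y].
  rewrite /e /halfspace; apply/seteqP; split=> y /=; case: (a j) => /=;
    by rewrite -Hx ?mul1r ?mulN1r ?oppr_gt0 ?subr_lt0 ?subr_gt0.
have mH j : measurable (halfspace (H j) (a j)).
  rewrite HE.
  have m : measurable_fun setT (fun y => e j * side x (f j) y).
    by apply: measurable_funM => //; exact: measurable_side.
  have := m measurableT `]0, +oo[ (measurable_itv _); rewrite setTI.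
  by congr measurable; apply/seteqP; split=> y /=; rewrite in_itv /= andbT.
have mO : measurable (orthant H a).
  by apply: fin_bigcap_measurable => // j _; exact: mH.
have <- : (\int[mu]_y (\1_(orthant H a) y)%:E = mu (orthant H a))%E.
  by rewrite integral_indic// setIT.
pose g (T : {set 'I_l}) y : \bar R := ((\prod_(j in T) e j)%:E *
  (parity x (f @: T) y)%:E)%E.
have ig T : mu.-integrable setT (g T).
  by apply: integrableZl => //; exact: integrable_parity.
transitivity (\int[mu]_y ((2 ^- l)%:E * \sum_(T : {set 'I_l}) g T y))%E.
  apply: ae_eq_integral => //.
  - by apply/measurable_EFinP; exact: measurable_indic.
  - apply: emeasurable_funM => //; apply: emeasurable_sum => T.
    exact: measurable_int (ig T).
  apply: filterS (ae_side_neq0 mu_ac x1) => y y0 _.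
  rewrite /g; under eq_bigr do rewrite -EFinM.
  rewrite sumEFin -EFinM; congr EFin.
  have -> : \sum_(T : {set 'I_l}) (\prod_(j in T) e j) * parity x (f @: T) y =
      \prod_j (1 + e j * Num.sg (side x (f j) y)).
    rewrite [RHS](eq_bigr (fun j => e j * Num.sg (side x (f j) y) + 1)); last first.
      by move=> j _; rewrite addrC.
    rewrite bigA_distr; apply: eq_bigr => T _.
    rewrite [RHS](bigID (mem T)) /= [X in _ = _ * X]big1 ?mulr1; last first.
      by move=> j /negbTE ->.
    rewrite /parity big_imset /=; last by move=> ? ? _ _ /fI.
    by rewrite -big_split; apply: eq_bigr => j /= ->.
  have -> : 2 ^- l = \prod_(j < l) (2^-1 : R) by rewrite prodr_const card_ord exprVn.
  rewrite -big_split /= indicE.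
  have E j : 2^-1 * (1 + e j * Num.sg (side x (f j) y)) = (0 < e j * side x (f j) y)%R%:R.
    have ese : Num.sg (e j) = e j by rewrite /e; case: (a j); rewrite ?sgrN sgr1.
    have ej : e j != 0 by rewrite /e; case: (a j); rewrite ?oppr_eq0 oner_eq0.
    rewrite -{1}ese -sgrM; case: sgrP (mulf_neq0 ej (y0 (f j))) => // _ _.
      by rewrite -[1 + 1]/(2%:R) mulVf ?pnatr_eq0.
    by rewrite subrr mulr0.
  rewrite (eq_bigr _ (fun j _ => E j)).
  have [yO|yO] := boolP (y \in orthant H a).
    rewrite big1// => j _; move: yO; rewrite inE => /(_ j Logic.I).
    by rewrite HE /= => ->.
  have [j yj] : exists j, ~~ (0 < e j * side x (f j) y).
    apply: contrapT => h; move/negP: yO; apply; rewrite inE => j _; rewrite HE /=.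
    by apply: contrapT => /negP yj; apply: h; exists j.
  by rewrite (bigD1 j)//= (negbTE yj) mul0r.
rewrite integralZl//; last first.
  exact: integrable_sum.
rewrite integral_sum//.
rewrite (bigD1 finset.set0)//= [X in (_ * (X + _))%E](_ : _ = 1%E); last first.
  rewrite (eq_integral (cst 1%E)).
    by rewrite integral_cst ?mul1e//; exact: probability_setT.
  by move=> y _; rewrite /g big_set0 imset0 parity0 mule1.
rewrite big1 ?adde0 ?mule1// => T T0; rewrite /g integralZl//.
  rewrite integral_parity ?mule0//; apply: xS.
  by rewrite card_imset// card_gt0 T0 -[leqRHS]card_ord max_card.
exact: integrable_parity.
Qed.

End Equipartition.

Section Hyperplanes.
Variables (R : realType) (n : nat).
Local Open Scope classical_set_scope.

Theorem any_equipart_zero (k m l : nat) (x : 'M[R]_(k, n.+1))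
    (mu : 'I_m -> probability (Rn R n) R) :
  (0 < m)%N -> (0 < l)%N -> (forall i, mu i `<< @lebesgueRn R n) -> unit_rows x ->
  (forall (S : {set 'I_k}) i, (0 < #|S| <= l)%N -> mean_parity (mu i) S x = 0) ->
  exists H : 'I_k -> hyperplane R n,
    (forall i c, tnth (normal (H i)) c = x i (lift ord0 c)) /\ any_equipart l mu H.
Proof.
move=> m0 l0 mu_ac x1 xS.
(* A row with zero normal would have a constant sign, and the mean over the singleton of [i] would
   be 1 or -1 instead of 0. *)
have nx i : exists c, x i (lift ord0 c) != 0.
  apply: contrapT => h.
  have xi0 c : x i (lift ord0 c) = 0.
    by apply/eqP; apply: contrapT => /negP h'; apply: h; exists c.
  have := xS [set i]%SET (Ordinal m0); rewrite cards1 => /(_ l0).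
  rewrite /mean_parity (@eq_Rintegral _ _ _ _ _ (cst (Num.sg (- x i ord0)))).
    rewrite Rintegral_cst// [fine _](_ : _ = 1) ?mulr1; 
      last exact: (congr1 fine (probability_setT (mu (Ordinal m0)))).
    move/eqP; rewrite sgr_eq0; apply/negP.
    have := side_affine [tuple 0 | _ < n] x1 xi0; rewrite /side big1 ?sub0r//.
    by move=> c _; rewrite xi0 mulr0.
  move=> y _; rewrite /parity big_set1 /side big1 ?sub0r// => c _.
  by rewrite xi0 mulr0.
have nv i : exists c,
    tnth [tuple (x i (lift ord0 c) : measurableTypeR R) | c < n] c != 0 :> R.
  by have [c xc] := nx i; exists c; rewrite tnth_mktuple.
exists (fun i => @Hyperplane R n [tuple x i (lift ord0 c) | c < n] (x i ord0) (nv i)).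
split=> [i c|f fI i]; first by rewrite tnth_mktuple.
apply: (equiparts_mean_parity (mu_ac i) x1 fI) => [j y|S]; last exact: xS.
by rewrite /dot /side; congr (_ - _); apply: eq_bigr => c _; rewrite tnth_mktuple.
Qed.

End Hyperplanes.

(** * Ideals and symmetric polynomials *)

Section Ideals.
Variables (A : comNzRingType) (r : nat) (g : 'I_r -> A).

Lemma in_ideal0 : in_ideal g 0.
Proof. by exists (fun=> 0); rewrite big1// => i _; rewrite mul0r. Qed.

Lemma in_idealD x y : in_ideal g x -> in_ideal g y -> in_ideal g (x + y).
Proof.
move=> [c ->] [d ->]; exists (fun i => c i + d i); rewrite -big_split.
by apply: eq_bigr => i _; rewrite mulrDl.
Qed.

Lemma in_idealM a x : in_ideal g x -> in_ideal g (a * x).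
Proof.
move=> [c ->]; exists (fun i => a * c i); rewrite mulr_sumr.
by apply: eq_bigr => i _; rewrite mulrA.
Qed.

Lemma in_idealB x y : in_ideal g x -> in_ideal g y -> in_ideal g (x - y).
Proof. by move=> gx gy; rewrite -mulN1r; apply/in_idealD/in_idealM. Qed.

Lemma in_ideal_sum I (s : seq I) (P : pred I) (F : I -> A) :
  (forall i, P i -> in_ideal g (F i)) -> in_ideal g (\sum_(i <- s | P i) F i).
Proof. by move=> H; elim/big_ind : _ => //; [exact: in_ideal0|exact: in_idealD]. Qed.

Lemma in_ideal_gen i : in_ideal g (g i).
Proof.
exists (fun j => (j == i)%:R); rewrite (bigD1 i)//= eqxx mul1r big1 ?addr0//.
by move=> j /negbTE ->; rewrite mul0r.
Qed.

Lemma in_idealS (r' : nat) (g' : 'I_r' -> A) a x :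
  (forall i, in_ideal g (a * g' i)) -> in_ideal g' x -> in_ideal g (a * x).
Proof.
move=> H [c ->]; rewrite mulr_sumr; apply: in_ideal_sum => i _.
by rewrite mulrCA; apply: in_idealM.
Qed.

End Ideals.

(** * Complete homogeneous polynomials and the Vandermonde product *)

Section CompleteSymmetric.
Variable A : comNzRingType.
Implicit Types (s : seq A) (r : nat).

(** The complete homogeneous polynomial h_r at the entries of [s], expanded by the exponent of the
    first one. *)
Fixpoint hsym r s : A :=
  if s is x :: s' then \sum_(i < r.+1) x ^+ i * hsym (r - i) s' else (r == 0)%:R.

Lemma hsymS r x s : hsym r.+1 (x :: s) = x * hsym r (x :: s) + hsym r.+1 s.
Proof.
rewrite /= big_ord_recl expr0 mul1r subn0 addrC mulr_sumr; congr (_ + _).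
by apply: eq_bigr => i _; rewrite exprS mulrA.
Qed.

Lemma hsym0 s : hsym 0 s = 1.
Proof. by elim: s => //= x s ih; rewrite big_ord1 expr0 mul1r. Qed.

Lemma hsym1 r x : hsym r [:: x] = x ^+ r.
Proof.
by elim: r => [|r ih]; rewrite ?hsym0// hsymS ih exprS /= addr0.
Qed.

(** In generating functions, 1/(1 - xu) - 1/(1 - yu) = (x - y)u / ((1 - xu)(1 - yu)). *)
Lemma hsym_diff r x y s :
  (x - y) * hsym r [:: x, y & s] = hsym r.+1 (x :: s) - hsym r.+1 (y :: s).
Proof.
elim: r => [|r ih]; first by rewrite !hsymS !hsym0; ring.
rewrite hsymS mulrDr mulrCA ih [hsym r.+2 (x :: s)]hsymS [hsym r.+2 (y :: s)]hsymS.
ring.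
Qed.

Fixpoint vandermonde s : A :=
  if s is x :: s' then (\prod_(y <- s') (x - y)) * vandermonde s' else 1.

Lemma vandermonde_cons x s :
  vandermonde (x :: s) = \prod_(y <- s) (x - y) * vandermonde s.
Proof. by []. Qed.

Variables (p : nat) (g : 'I_p -> A).

(* The divided differences [hsym_diff] reduce the number of variables, ending with
   [hsym r [:: x] = x ^+ r]. *)
Lemma vandermonde_hsym N r s : s != [::] ->
  (forall x, x \in s -> in_ideal g (x ^+ N)) -> (N < r + size s)%N ->
  in_ideal g (vandermonde s * hsym r s).
Proof.
have [m ms] := ubnP (size s); elim: m r s ms => // m ih r [//|x [|y s]] sm _ xN.
  move=> Nr; rewrite hsym1 /= big_nil !mul1r.
  have /subnK <- : (N <= r)%N by move: Nr; rewrite addn1 ltnS.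
  by rewrite exprD; apply: in_idealM; apply: xN; rewrite mem_head.
move=> Nr.
have -> : vandermonde [:: x, y & s] * hsym r [:: x, y & s] =
    \prod_(z <- s) (y - z) * (vandermonde (x :: s) * hsym r.+1 (x :: s)) -
    \prod_(z <- s) (x - z) * (vandermonde (y :: s) * hsym r.+1 (y :: s)).
  rewrite !vandermonde_cons big_cons.
  transitivity ((\prod_(z <- s) (y - z) * \prod_(z <- s) (x - z) * vandermonde s) *
      ((x - y) * hsym r [:: x, y & s])); first by ring.
  by rewrite hsym_diff; ring.
apply: in_idealB; apply: in_idealM; apply: ih => //.
- by move=> z; rewrite inE => /orP[/eqP ->|zs]; apply: xN; rewrite !inE ?eqxx// zs !orbT.
- by rewrite /= addSnnS.
- move=> z; rewrite inE => /orP[/eqP ->|zs]; apply: xN; rewrite !inE.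
    by rewrite eqxx orbT.
  by rewrite zs !orbT.
- by rewrite /= addSnnS.
Qed.

End CompleteSymmetric.

Section Multinomial.
Variable k : nat.
Implicit Types i : 'I_k -> nat.

Definition multinomial i := ((\sum_j i j)`! %/ \prod_j (i j)`!)%N.

Definition decr i j : 'I_k -> nat := fun b => (i b - (b == j))%N.

Lemma sum_decr i j : (0 < i j)%N -> (\sum_b i b = (\sum_b decr i j b).+1)%N.
Proof.
move=> ij; rewrite (bigD1 j)//= [in RHS](bigD1 j)//= /decr eqxx subn1.
rewrite -addSn prednK//; congr (_ + _)%N; apply: eq_bigr => b /negbTE ->.
by rewrite subn0.
Qed.

Lemma prod_fact_decr i j : (0 < i j)%N ->
  (\prod_b (i b)`! = i j * \prod_b (decr i j b)`!)%N.
Proof.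
move=> ij; rewrite (bigD1 j)//= [in RHS](bigD1 j)//= /decr eqxx subn1 mulnA.
rewrite -{1}(prednK ij) factS prednK//; congr (_ * _)%N.
by apply: eq_bigr => b /negbTE ->; rewrite subn0.
Qed.

(** With n + 1 the sum of the [i j], (n + 1)! is the sum of the [i j] times n!, and by induction n!
    is divisible by the product of factorials of [decr i j]. *)
Lemma dvdn_prod_fact i : (\prod_j (i j)`! %| (\sum_j i j)`!)%N.
Proof.
have [N] := ubnP (\sum_j i j); elim: N i => // N ih i iN.
have [i0|/lt0n_neq0] := posnP (\sum_j i j).
  rewrite big1 ?dvd1n// => j _.
  by move/eqP: i0; rewrite sum_nat_eq0 => /forallP/(_ j)/eqP ->.
case E : (\sum_j i j)%N => [//|n] _.
rewrite factS -{1}E big_distrl [X in (_ %| X)%N](bigID (fun j => 0 < i j)%N) /=.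
rewrite [X in (_ + X)%N]big1 ?addn0 => [|j]; last by rewrite -eqn0Ngt => /eqP ->.
apply: dvdn_sum => j ij; rewrite (prod_fact_decr ij) dvdn_mul//.
have -> : n = (\sum_b decr i j b)%N by apply: succn_inj; rewrite -sum_decr.
by apply: ih; rewrite -ltnS -sum_decr.
Qed.

(** Pascal's rule: after clearing denominators, the leading factor of the factorial is split into
    the [i j]. *)
Lemma multinomialE i : (0 < \sum_j i j)%N ->
  multinomial i = (\sum_(j | 0 < i j) multinomial (decr i j))%N.
Proof.
move=> i0; apply/eqP.
have D0 : (0 < \prod_j (i j)`!)%N by apply: prodn_gt0 => j; exact: fact_gt0.
rewrite -(eqn_pmul2l D0).
rewrite [X in X == _]mulnC divnK ?dvdn_prod_fact// big_distrr /=.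
case E : (\sum_j i j)%N i0 => [//|n] _.
rewrite factS -{1}E big_distrl [X in X == _](bigID (fun j => 0 < i j)%N) /=.
rewrite [X in (_ + X)%N]big1 ?addn0 => [|j]; last by rewrite -eqn0Ngt => /eqP ->.
apply/eqP; apply: eq_bigr => j ij; rewrite (prod_fact_decr ij) -mulnA; congr (_ * _)%N.
rewrite mulnC divnK ?dvdn_prod_fact//; congr (_`!).
by apply: succn_inj; rewrite -sum_decr.
Qed.

End Multinomial.

(** * Dual classes as complete homogeneous polynomials *)

Section Wbar.
Variable k : nat.
Local Notation A := (polyA k).
Local Notation vars := (map (@tvar k) (enum 'I_k)).

Lemma polyF2_addrr (p : A) : p + p = 0.
Proof.
apply: addrr_pchar2; rewrite inE /= -(rmorph_nat (@mpolyC k 'F_2)).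
by rewrite (pcharf0 (pchar_Fp (isT : prime 2))) rmorph0.
Qed.

Lemma polyF2_opp (p : A) : - p = p.
Proof. by apply/eqP; rewrite eq_sym -addr_eq0 polyF2_addrr. Qed.

Fixpoint elsym j (s : seq A) : A :=
  match s, j with
  | [::], _ => (j == 0)%:R
  | x :: s', 0 => 1
  | x :: s', j'.+1 => elsym j s' + x * elsym j' s'
  end.

Lemma elsym0 s : elsym 0 s = 1.
Proof. by case: s. Qed.

Lemma elsymS j x s : elsym j.+1 (x :: s) = elsym j.+1 s + x * elsym j s.
Proof. by []. Qed.

Lemma elsym_geq j s : (size s < j)%N -> elsym j s = 0.
Proof.
by elim: s j => [|x s ih] [|j]//= sj; rewrite !ih ?mulr0 ?addr0// ltnW.
Qed.

(** Modulo 2 the generating functions, the products of the 1 + xu and of the 1/(1 - xu), are inverse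
    to each other. *)
Lemma elsym_hsym r s :
  \sum_(j < r.+1) elsym j s * hsym (r - j) s = (r == 0)%:R.
Proof.
elim: s r => [|x s ih] r.
  rewrite big_ord_recl /= subn0 mul1r big1 ?addr0// => j _.
  by rewrite mul0r.
case: r => [|r]; first by rewrite big_ord1 elsym0 hsym0 mulr1.
rewrite -[RHS](ih r.+1) big_ord_recl elsym0 mul1r subn0.
rewrite [in RHS]big_ord_recl elsym0 mul1r subn0 hsymS.
pose S := \sum_(j < r.+1) elsym j s * hsym (r - j) (x :: s).
pose V := \sum_(j < r.+1) elsym j.+1 s * hsym (r - j) s.
pose U := \sum_(j < r) elsym j.+1 s * hsym (r - j.+1) (x :: s).
have -> : \sum_(j < r.+1) elsym (lift ord0 j) (x :: s) *
    hsym (r.+1 - lift ord0 j) (x :: s) =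
    \sum_(j < r.+1) elsym j.+1 s * hsym (r - j) (x :: s) + x * S.
  rewrite mulr_sumr -big_split; apply: eq_bigr => j _.
  rewrite lift0 subSS elsymS -[RHS]/(_ + _).
  by move: (hsym _ (x :: s)) => h; ring.
have -> : \sum_(j < r.+1) elsym (lift ord0 j) s * hsym (r.+1 - lift ord0 j) s = V.
  by apply: eq_bigr => j _; rewrite lift0 subSS.
have -> : \sum_(j < r.+1) elsym j.+1 s * hsym (r - j) (x :: s) = V + x * U.
  rewrite /V /U mulr_sumr [in LHS]big_ord_recr [X in _ = X + _]big_ord_recr.
  rewrite addrAC -big_split; congr (_ + _); last by rewrite [(r - _)%N]subnn !hsym0.
  apply: eq_bigr => j _; rewrite -[nat_of_ord (widen_ord _ j)]/(nat_of_ord j).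
  rewrite -(subnSK (ltn_ord j)) hsymS -[RHS]/(_ + _).
  by move: (hsym _ (x :: s)) => h; ring.
have -> : S = hsym r (x :: s) + U by rewrite /S big_ord_recl elsym0 mul1r subn0.
move: (hsym r (x :: s)) V U (hsym r.+1 s) => a b c d.
(* After these expansions every term with a factor [x] occurs twice. *)
have : x * a + x * a + (x * c + x * c) = 0 by rewrite !polyF2_addrr.
by move=> E; rewrite -[RHS]addr0 -E; ring.
Qed.

(** Both are the coefficient of X^j in the product of the 1 + t_i X, expanded by recursion and over
    subsets. *)
Lemma elsym_vars j : elsym j vars = wsym k j.
Proof.
have E (s : seq A) : \prod_(x <- s) (1 + x%:P * 'X) = \poly_(i < (size s).+1) elsym i s.
  elim: s => [|x s ih].
    by rewrite big_nil; apply/polyP => i; rewrite coef_poly coef1; case: i.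
  rewrite big_cons ih; apply/polyP => i; rewrite mulrDl mul1r -mulrA coefD.
  rewrite coefCM coefXM !coef_poly /=.
  case: i => [|i] /=; first by rewrite elsym0 mulr0 addr0.
  rewrite !ltnS; case: (leqP i (size s)) => si; last first.
    by rewrite ltnNge ltnW// mulr0 addr0.
  by case: ltnP => // si'; rewrite (@elsym_geq i.+1).
have := congr1 (fun p : {poly A} => p`_j) (E vars).
rewrite coef_poly ltnS big_map big_enum /=.
under eq_bigr do rewrite addrC.
rewrite bigA_distr coef_sum size_map size_enum_ord.
have -> : \sum_(J : {set 'I_k})
    (\prod_(i < k) (if i \in J then (tvar i)%:P * 'X else 1))`_j = wsym k j.
  rewrite (bigID (fun J : {set 'I_k} => #|J| == j)) /=.
  have JE (J : {set 'I_k}) :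
      (\prod_(i < k) (if i \in J then (tvar i)%:P * 'X else 1 : {poly A}))`_j =
      (\prod_(i in J) tvar i) *+ (j == #|J|).
    rewrite -big_mkcond /= big_split /= -rmorph_prod /= prodr_const coefCM coefXn.
    by rewrite mulr_natr.
  rewrite [X in _ + X]big1 ?addr0 => [|J /negbTE Jj]; last by rewrite JE eq_sym Jj.
  by apply: eq_bigr => J /eqP Jj; rewrite JE Jj eqxx mulr1n.
by case: leqP => [_ //|kj ->]; rewrite elsym_geq// size_map size_enum_ord.
Qed.

Lemma hsym_rec r : hsym r.+1 vars =
  \sum_(j < k | (j <= r)%N) wsym k j.+1 * hsym (r - j) vars.
Proof.
have E : hsym r.+1 vars = \sum_(j < r.+1) elsym j.+1 vars * hsym (r - j) vars.
  have := elsym_hsym r.+1 vars; rewrite big_ord_recl elsym0 mul1r subn0.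
  by move/eqP; rewrite addr_eq0 polyF2_opp => /eqP ->.
rewrite E; under eq_bigr do rewrite elsym_vars.
(* The two index ranges are embedded in a common one, where the terms with [j >= k] vanish because
   [wsym k j.+1] is 0. *)
rewrite (@big_ord_widen _ _ _ r.+1 (k + r.+1)
  (fun j => wsym k j.+1 * hsym (r - j) vars)) ?leq_addl//.
rewrite (@big_ord_widen_cond _ _ _ k (k + r.+1) (fun j => (j <= r)%N)
  (fun j => wsym k j.+1 * hsym (r - j) vars)) ?leq_addr//.
rewrite (bigID (fun j : 'I_(k + r.+1) => (j < k)%N)) /= [X in _ + X]big1 ?addr0//.
by move=> j /andP[_]; rewrite -leqNgt => kj; rewrite /wsym mesym_geqnE// mul0r.
Qed.

(** Both sides satisfy the recursion [hsym_rec]: in [wbar_nat], Pascal's rule splits off one factor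
    [wsym k j.+1]. *)
Lemma wbarE r : wbar_nat k r = hsym r vars.
Proof.
(* The bound [B] on the exponents is decoupled from the weight [s], so that the index type stays
   fixed during the induction. *)
pose w B (s : nat) := \sum_(i : {ffun 'I_k -> 'I_B.+1} | (\sum_(j < k) j.+1 * i j == s)%N)
  (\prod_(j < k) wsym k j.+1 ^+ i j) *+ multinomial (fun j => i j).
suff H B s : (s <= B)%N -> w B s = hsym s vars by rewrite -(H r).
have [t] := ubnP s; elim: t s => // t ih [_ _|s st sB].
  rewrite hsym0 /w (big_pred1 [ffun=> ord0]) => [|i].
    rewrite big1 => [|j _]; last by rewrite ffunE expr0.
    by rewrite /multinomial !big1 // => j _; rewrite ffunE.
  rewrite sum_nat_eq0; apply/forallP/eqP => [h|-> j]; last by rewrite ffunE muln0.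
  apply/ffunP => j; apply: val_inj; rewrite ffunE /=.
  by have := h j; rewrite mulSn addn_eq0 => /andP[/eqP].
rewrite hsym_rec /w.
transitivity (\sum_(i : {ffun 'I_k -> 'I_B.+1} | (\sum_(j < k) j.+1 * i j == s.+1)%N)
  \sum_(j | (0 < i j)%N) wsym k j.+1 *
    ((\prod_(b < k) wsym k b.+1 ^+ decr (fun c => i c) j b) *+
     multinomial (decr (fun c => i c) j))).
  apply: eq_bigr => i /eqP wi; rewrite multinomialE; last first.
    rewrite lt0n; apply: contra_eqN wi => /eqP/eqP; rewrite sum_nat_eq0 => /forallP i0.
    by rewrite big1// => j _; move/eqP: (i0 j) => ->; rewrite muln0.
  rewrite -sumrMnr; apply: eq_bigr => j ij; rewrite mulrnAr; congr (_ *+ _).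
  rewrite (bigD1 j)//= [in RHS](bigD1 j)//= mulrA -exprS /decr eqxx subn1 prednK//.
  by congr (_ * _); apply: eq_bigr => b /negbTE ->; rewrite subn0.
rewrite (exchange_big_dep predT)//= [RHS]big_mkcond /=; apply: eq_bigr => j _.
have wtE (i i' : 'I_k -> nat) : (forall b, i' b = i b + (b == j))%N ->
    (\sum_(b < k) b.+1 * i' b = \sum_(b < k) b.+1 * i b + j.+1)%N.
  move=> ii'; under eq_bigr do rewrite ii'.
  rewrite (eq_bigr (fun b : 'I_k => b.+1 * i b + b.+1 * (b == j))%N); last first.
    by move=> b _; rewrite mulnDr.
  rewrite big_split /= [X in (_ + X)%N](bigD1 j)//= eqxx muln1.
  by rewrite [X in (_ + (_ + X))%N]big1 ?addn0// => b /negbTE ->; rewrite muln0.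
case: leqP => [js|sj]; last first.
  rewrite big_pred0// => i; apply/negP => /andP[/eqP wi ij].
  move: wi; rewrite (wtE (decr (fun c => i c) j)) => [|b]; last first.
    by rewrite /decr subnK//; case: eqVneq => // ->.
  by move=> wi; move: sj; rewrite -ltnS -wi ltnNge leq_addl.
rewrite -mulr_sumr -(ih (s - j)%N).
- congr (_ * _).
  (* Raising and lowering the exponent at [j] match the exponents of weight s - j with those of
     weight s + 1 that are positive at [j]. *)
  pose up (i : {ffun 'I_k -> 'I_B.+1}) : {ffun 'I_k -> 'I_B.+1} :=
    [ffun b => inord (i b + (b == j))].
  pose dn (i : {ffun 'I_k -> 'I_B.+1}) : {ffun 'I_k -> 'I_B.+1} :=
    [ffun b => inord (decr (fun c => i c) j b)].
  have dnE i b : dn i b = decr (fun c => i c) j b :> nat.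
    by rewrite ffunE inordK// ltnS (leq_trans (leq_subr _ _))// -ltnS.
  have dnj (i : {ffun 'I_k -> 'I_B.+1}) : (0 < i j)%N ->
      forall b, (dn i b + (b == j) = i b)%N.
    by move=> ij b; rewrite dnE subnK//; case: eqVneq => // ->.
  rewrite (reindex_onto up dn) /=; last first.
    move=> i /andP[_ ij]; apply/ffunP => b.
    by rewrite ffunE dnj// inord_val.
  have upE (i : {ffun 'I_k -> 'I_B.+1}) : (\sum_(b < k) b.+1 * i b == s - j)%N ->
      forall b, (up i b = i b + (b == j) :> nat)%N.
    move=> /eqP wi b; rewrite ffunE inordK// ltnS.
    have ib : (i b <= s - j)%N.
      by rewrite -wi (bigD1 b)//= (leq_trans _ (leq_addr _ _))// leq_pmull.
    apply: leq_trans sB; rewrite -[s.+1]addn1 leq_add ?leq_b1//.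
    exact: leq_trans ib (leq_subr _ _).
  apply/esym; apply: eq_big => [i|i wi].
    apply/idP/idP => [wi|/andP[/andP[wi ij] /eqP di]].
      have uE := upE i wi.
      rewrite (wtE (fun c => i c) _ uE) (eqP wi) addnS subnK// eqxx /=.
      rewrite uE eqxx addn1 /=; apply/eqP/ffunP => b; apply: val_inj.
      by rewrite /= dnE /decr uE addnK.
    have := wtE _ (fun c => up i c) (fun b => esym (dnj _ ij b)).
    by rewrite di (eqP wi) => /eqP; rewrite addnS eqSS -{1}(subnK js) eqn_add2r eq_sym.
  have uE := upE i wi.
  have dE b : decr (fun c => up i c) j b = i b by rewrite /decr uE addnK.
  congr (_ *+ _); first by apply: eq_bigr => b _; rewrite dE.
  rewrite /multinomial; congr (_`! %/ _)%N; apply: eq_bigr => b _; rewrite dE//.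
- by move: st; rewrite ltnS; apply: leq_ltn_trans (leq_subr _ _).
- by rewrite (leq_trans (leq_subr _ _))// ltnW.
Qed.

End Wbar.

(** * Leading monomials, with t_1 the largest variable *)

Section LeadingMonomials.
Variable k : nat.
Local Notation A := (polyA k).
Implicit Types (i j : 'I_k) (s : seq 'I_k) (p q : A).
Local Notation lt_ord := (relpre (@nat_of_ord k) ltn).

Lemma mnm1_muln_lt i j r : (i < j)%N ->
  (mnm_muln (mnm1 j) r.+1 < mnm_muln (mnm1 i) r.+1)%O.
Proof.
move=> ij; apply/ltmcP; first by rewrite !mdegMn !mdeg1.
have E (a b : 'I_k) : (a < b)%N -> mnm1 b a = 0%N :> nat.
  by move=> ab; rewrite mnm1E; case: eqVneq ab => // ->; rewrite ltnn.
exists i => [a ai|]; rewrite !mulmnE; last by rewrite (E i j ij) mnm1E eqxx.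
by rewrite (E a j (ltn_trans ai ij)) (E a i ai).
Qed.

Lemma mnm1_lt i j : (i < j)%N -> (mnm1 j < mnm1 i)%O.
Proof. by move=> ij; have := mnm1_muln_lt 0 ij; rewrite !mulm1n. Qed.

Lemma tvar_neq0 i : tvar i != 0.
Proof. by rewrite /tvar -msize_poly_eq0 msizeX. Qed.

Lemma mlead_tvar i : mlead (tvar i) = mnm1 i.
Proof. exact: mleadXm. Qed.

(** In [hsymS] the summand with factor [tvar i] dominates, since the other involves only smaller
    variables. *)
Lemma mlead_hsym i s r : path lt_ord i s ->
  hsym r (map (@tvar k) (i :: s)) != 0 /\
  mlead (hsym r (map (@tvar k) (i :: s))) = mnm_muln (mnm1 i) r.
Proof.
elim: s i r => [|j s ih] i r.
  by rewrite hsym1 expf_neq0 ?tvar_neq0// mleadX ?tvar_neq0// mlead_tvar.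
rewrite [path _ _ _]/= => /andP[ij js]; elim: r => [|r [IH1 IH2]].
  by rewrite hsym0 oner_neq0 mlead1 mulm0n.
have L : mlead (hsym r.+1 (map (@tvar k) [:: i, j & s])) = mnm_muln (mnm1 i) r.+1.
  have E : mlead (tvar i * hsym r [seq tvar a | a <- [:: i, j & s]]) =
      mnm_muln (mnm1 i) r.+1.
    by rewrite mleadM ?tvar_neq0// IH2 mlead_tvar mulmS.
  rewrite map_cons hsymS mleadDl E//.
  by have [_ ->] := ih j r.+1 js; exact: mnm1_muln_lt.
split=> //; apply/eqP => h0; have := congr1 (@mdeg k) L.
by rewrite h0 mlead0 mdeg0 mdegMn mdeg1.
Qed.

Definition delta : A := \prod_(p : 'I_k * 'I_k | (p.1 < p.2)%N) (tvar p.1 + tvar p.2).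

Lemma delta_pair : delta = \prod_(i < k) \prod_(j < k | (i < j)%N) (tvar i + tvar j).
Proof. by rewrite /delta pair_big_dep. Qed.

Lemma mlead_tvarD i j : (i < j)%N -> mlead (tvar i + tvar j) = mnm1 i.
Proof. by move=> ij; rewrite mleadDl !mlead_tvar// mnm1_lt. Qed.

Lemma tvarD_neq0 i j : (i < j)%N -> tvar i + tvar j != 0.
Proof.
move=> ij; apply/eqP => h; have := congr1 (@mdeg k) (mlead_tvarD ij).
by rewrite h mlead0 mdeg0 mdeg1.
Qed.

Lemma delta_neq0 : delta != 0.
Proof. by apply/prodf_neq0 => p; apply: tvarD_neq0. Qed.

(** Each factor t_i + t_j with i < j leads with t_i, and [i] is the smaller index in k - 1 - i
    pairs. *)
Lemma mlead_delta i : (mlead delta i + i.+1 = k)%N.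
Proof.
rewrite delta_pair mlead_prod => [|a _ _]; last first.
  by apply/prodf_neq0 => j; apply: tvarD_neq0.
have E (a : 'I_k) : mlead (\prod_(j < k | (a < j)%N) (tvar a + tvar j)) i =
    (\sum_(j < k | (a < j)%N) (a == i))%N.
  rewrite mlead_prod => [|j _]; last exact: tvarD_neq0.
  by rewrite mnm_sumE; apply: eq_bigr => j aj; rewrite mlead_tvarD// mnm1E.
rewrite mnm_sumE (bigD1 i)//= E [X in (_ + X + i.+1)%N]big1 => [|a /negbTE ai].
  rewrite addn0; have := big_geq_mkord i.+1 k predT (fun=> (i == i : nat)) => /= <-.
  by rewrite eqxx sum_nat_const_nat muln1 subnK.
by rewrite E big1// => j _; rewrite ai.
Qed.

Lemma delta_vandermonde : delta = vandermonde (map (@tvar k) (enum 'I_k)).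
Proof.
have H (s : seq 'I_k) : sorted lt_ord s -> vandermonde (map (@tvar k) s) =
    \prod_(i <- s) \prod_(j <- s | (i < j)%N) (tvar i + tvar j).
  elim: s => [|i s ih] //=; first by rewrite big_nil.
  have tr : transitive lt_ord by move=> a b c; apply: ltn_trans.
  move=> is_s; have /allP js := order_path_min tr is_s.
  rewrite big_cons big_cons ltnn ih ?(path_sorted is_s)// big_map; congr (_ * _).
    rewrite [RHS]big_seq_cond [LHS]big_seq.
    apply: eq_big => [j|j _]; last by rewrite polyF2_opp.
    by case: (boolP (j \in s)) => // /js.
  rewrite big_seq [RHS]big_seq; apply: eq_bigr => a /js ia.
  by rewrite big_cons ltnNge ltnW.
rewrite H ?big_enum ?delta_pair//.
  by apply: eq_bigr => i _; rewrite big_enum_cond.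
by rewrite -sorted_map val_enum_ord iota_ltn_sorted.
Qed.

End LeadingMonomials.

Section PowerIdeal.
Variables (k N : nat).
Local Notation A := (polyA k).
Local Notation powers := (fun i : 'I_k => tvar i ^+ N : A).

Lemma mcoeff_in_powers (p : A) (a : multinom k) :
  in_ideal powers p -> (forall i, (a i < N)%N) -> mcoeff a p = 0.
Proof.
move=> [c ->] aN; rewrite raddf_sum big1// => i _ /=.
rewrite /tvar mpolyXn; apply/eqP; rewrite mcoeff_eq0; apply/negP.
rewrite (perm_mem (msuppMX _ _)) => /mapP[b _ ab].
by have := aN i; rewrite ab mnmDE mulmnE mnm1E eqxx mul1n ltnNge leq_addr.
Qed.

(** The ideal is monomial: were some exponent at least [N] in every monomial of [p], all of them
    would lie in it. *)
Lemma notin_powers (p : A) : ~ in_ideal powers p ->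
  exists2 a : multinom k, (forall i, (a i < N)%N) & mcoeff a p != 0.
Proof.
move=> pN; apply: contrapT => h; apply: pN; rewrite [p]mpolyE big_seq.
apply: in_ideal_sum => m; rewrite mcoeff_msupp => pm.
have [i mi] : exists i, (N <= m i)%N.
  apply: contrapT => h'; apply: h; exists m => // i; rewrite ltnNge.
  by apply/negP => mi; apply: h'; exists i.
have -> : mpolyX 'F_2 m = mpolyX 'F_2 (mnm_sub m (mnm_muln (mnm1 i) N)) * tvar i ^+ N.
  rewrite /tvar mpolyXn -mpolyXD submK//; apply/mnm_lepP => j.
  by rewrite mulmnE mnm1E; case: eqVneq => [<-|]; rewrite ?mul1n.
by rewrite scalerAl; apply: in_idealM; exact: in_ideal_gen.
Qed.

End PowerIdeal.

(** * The ideal of dual classes and its detection by [delta] *)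

Section DualClasses.
Variables (k n : nat).
Hypothesis kn : (k <= n)%N.
Local Notation A := (polyA k).
Local Notation vars := (map (@tvar k) (enum 'I_k)).
Local Notation wbars := (fun j : 'I_k => wbar k (n%:Z - k%:Z + 1 + j%:Z)).

Lemma wbars_hsym (j : 'I_k) : wbars j = hsym (n - k + j.+1) vars.
Proof. by rewrite subzn// -!PoszD /wbar wbarE addn1 addnS addSn. Qed.

(** h_r(t_{i+1}, ...) = h_r(t_i, ...) - t_i h_{r-1}(t_i, ...), so each dropped variable costs the
    lowest degree of the range. *)
Lemma in_wbars_hsym (i r : nat) : (n - k + i < r <= n)%N -> (i < k)%N ->
  in_ideal wbars (hsym r (drop i vars)).
Proof.
elim: i r => [|i ih] r /andP[ir rn] ik.
  have rk : (r - (n - k).+1 < k)%N by lia.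
  have := in_ideal_gen wbars (Ordinal rk); rewrite wbars_hsym drop0 /=.
  by congr (in_ideal _ (hsym _ _)); lia.
have E : drop i vars = tvar (Ordinal (ltnW ik)) :: drop i.+1 vars.
  have sz : size (enum 'I_k) = k by exact: size_enum_ord.
  have szv : size vars = k by rewrite size_map sz.
  rewrite (drop_nth 0); last by rewrite szv ltnW.
  rewrite (nth_map (Ordinal ik)); last by rewrite sz ltnW.
  congr (tvar _ :: _).
  by apply: val_inj; rewrite /= nth_enum_ord// ltnW.
case: r ir rn => // r ir rn.
have -> : hsym r.+1 (drop i.+1 vars) =
    hsym r.+1 (drop i vars) - tvar (Ordinal (ltnW ik)) * hsym r (drop i vars).
  by rewrite E hsymS addrC addKr.
by apply: in_idealB; [|apply: in_idealM]; apply: ih; lia.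
Qed.

Lemma lead_in_wbars (i : 'I_k) : exists h : A,
  [/\ in_ideal wbars h, h != 0 & mlead h = mnm_muln (mnm1 i) (n - k + i.+1)].
Proof.
exists (hsym (n - k + i.+1) (drop i vars)).
have E : drop i vars = map (@tvar k) (i :: drop i.+1 (enum 'I_k)).
  rewrite -map_drop (drop_nth i) ?size_enum_ord//; congr (map _ (_ :: _)).
  by apply: val_inj; rewrite /= nth_enum_ord.
have /(mlead_hsym (n - k + i.+1)) [h0 hm] :
    path (relpre (@nat_of_ord k) ltn) i (drop i.+1 (enum 'I_k)).
  have : sorted (relpre (@nat_of_ord k) ltn) (drop i (enum 'I_k)).
    by apply: drop_sorted; rewrite -sorted_map val_enum_ord iota_ltn_sorted.
  rewrite (drop_nth i) ?size_enum_ord//=; congr path.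
  by apply: val_inj; rewrite /= nth_enum_ord.
split; rewrite ?E//; rewrite -E; apply: in_wbars_hsym => //.
by have := ltn_ord i; lia.
Qed.

(** Division by the elements of [lead_in_wbars], by well-founded induction on the leading monomial;
    it stops once that monomial alone is reduced. *)
Lemma wbars_reduce (p : A) : ~ in_ideal wbars p -> exists r : A,
  [/\ in_ideal wbars (p - r), r != 0 & forall i, (mlead r i <= n - k + i)%N].
Proof.
have [m pm] : exists m, mlead p = m by exists (mlead p).
elim/(@ltmwf k) : m p pm => m ih p pm pN.
have p0 : p != 0 by apply/eqP => p0; apply: pN; rewrite p0; exact: in_ideal0.
have [H|H] := pselect (forall i, (mlead p i <= n - k + i)%N).
  by exists p; split=> //; rewrite subrr; exact: in_ideal0.
have [i pi] : exists i : 'I_k, (n - k + i < mlead p i)%N.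
  apply: contrapT => h; apply: H => i; rewrite leqNgt; apply/negP => pi.
  by apply: h; exists i.
have [h [hI h0 hm]] := lead_in_wbars i.
pose u : A := mpolyX 'F_2 (mnm_sub (mlead p) (mlead h)).
have u0 : u != 0 by rewrite /u -msize_poly_eq0 msizeX.
have uhm : mlead (u * h) = mlead p.
  rewrite mleadM// mleadXm submK//; apply/mnm_lepP => j.
  rewrite hm mulmnE mnm1E; case: eqVneq => [<-|_]; rewrite ?mul1n//.
  by rewrite addnS.
(* Over F_2 leading coefficients are 1, so subtracting [u * h] cancels the leading term of [p]. *)
have lead1 (f : A) : f != 0 -> mcoeff (mlead f) f = 1.
  by rewrite -mleadc_eq0; case: (F2_cases (mcoeff (mlead f) f)) => ->; rewrite ?eqxx.
have uhI : in_ideal wbars (u * h) by exact: in_idealM.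
have pN' : ~ in_ideal wbars (p - u * h).
  by move=> H'; apply: pN; rewrite -[p](subrK (u * h)); exact: in_idealD.
have p'0 : p - u * h != 0 by apply/eqP => H'; apply: pN'; rewrite H'; exact: in_ideal0.
have p'm : (mlead (p - u * h) < m)%O.
  rewrite lt_neqAle -pm; apply/andP; split; last first.
    by have := mleadB_le p (u * h); rewrite uhm joinxx.
  apply: contraNneq p'0 => E; rewrite -mleadc_eq0 E mcoeffB -{2}uhm !lead1 ?subrr//.
  by rewrite mulf_neq0.
have [r [rI r0 rm]] := ih _ p'm _ erefl pN'.
exists r; split=> //.
have -> : p - r = (p - u * h - r) + u * h by rewrite addrAC subrK.
exact: in_idealD.
Qed.

(* [delta] is the class dual to the flag manifold in the product of projective
   spaces, so multiplying by it detects nonzero classes. *)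
Lemma delta_notin_powers (q : A) : ~ in_ideal wbars q ->
  exists2 a : multinom k, (forall i, (a i < n)%N) & mcoeff a (q * delta k) != 0.
Proof.
(* The exponents sum to at most (n - k + i) + (k - 1 - i) = n - 1. *)
move=> /wbars_reduce[r [rI r0 rm]]; have bound i : (mlead r i + mlead (delta k) i < n)%N.
  move: (mlead_delta i) (rm i) kn (ltn_ord i).
  by move: (mlead (delta k) i) (mlead r i) (nat_of_ord i) => x y z; lia.
exists (mlead (r * delta k)).
  move=> i; rewrite mleadM ?delta_neq0// mnmDE.
  exact: bound.
rewrite -(subrK r q) mulrDl mcoeffD (@mcoeff_in_powers _ n) ?add0r.
- by rewrite mleadc_eq0 mulf_neq0// delta_neq0.
- rewrite mulrC; apply: in_idealS rI => j; rewrite wbars_hsym delta_vandermonde.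
  apply: (@vandermonde_hsym _ _ (fun i : 'I_k => tvar i ^+ n) n).
  + by rewrite -size_eq0 size_map [size _]size_enum_ord -lt0n (leq_ltn_trans (leq0n j)).
  + by move=> x /mapP[i _ ->]; exact: in_ideal_gen.
  + by rewrite size_map [size _]size_enum_ord addnAC subnK// addnS ltnS leq_addr.
- move=> i; rewrite mleadM ?delta_neq0// mnmDE.
  exact: bound.
Qed.

End DualClasses.

(** * Equipartitions *)

Section Main.
Variables (R : realType) (n m k l : nat).
Import numFieldNormedType.Exports.
Local Open Scope classical_set_scope.
Hypotheses (m0 : (0 < m)%N) (l0 : (0 < l)%N).
Variable mu : 'I_m -> probability (Rn R n) R.
Hypothesis mu_ac : forall i, mu i `<< @lebesgueRn R n.

Theorem equipart_orthogonal (prs : seq ('I_k * 'I_k)) (a : multinom k) :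
  {in prs, forall p, p.1 != p.2} -> (forall i, a i <= n)%N ->
  mcoeff a (sprod m k l * \prod_(p <- prs) (tvar p.1 + tvar p.2)) != 0 ->
  exists H : 'I_k -> hyperplane R n,
    {in prs, forall p, dot (normal (H p.1)) (normal (H p.2)) = 0} /\
    any_equipart l mu H.
Proof.
move=> prsN an ca.
pose J := ({ffun 'I_k -> bool} * 'I_m + 'I_k * 'I_k)%type.
pose P (s : {ffun 'I_k -> bool}) := (1 <= \sum_(j < k) s j <= l)%N.
pose js : seq J := [seq inl t | t <- [seq (s, i) | s <- enum P, i <- enum 'I_m]] ++
  [seq inr p | p <- prs].
(* A degenerate pair gets the trivial character and the zero function, so that [F_flip] holds at
   every index; [prsN] keeps such pairs out of [js]. *)
pose c (j : J) (i : 'I_k) : bool := match j with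
  | inl (s, _) => s i
  | inr p => (p.1 != p.2) && ((i == p.1) || (i == p.2))
  end.
pose F (j : J) (x : 'M[R]_(k, n.+1)) : R := match j with
  | inl (s, i) => mean_parity (mu i) [set b | s b]%SET x
  | inr p => if p.1 != p.2 then
      \sum_d x p.1 (lift ord0 d) * x p.2 (lift ord0 d) else 0
  end.
have F_flip j i x : unit_rows x ->
    F j (flip_mx i x) = if c j i then - F j x else F j x.
  move=> _; case: j => [[s i']|p] /=; first by rewrite mean_parity_flip inE.
  have [pp|pN] /= := eqVneq p.1 p.2; first by [].
  have E (b : R) : (forall d, flip_mx i x p.1 (lift ord0 d) *
        flip_mx i x p.2 (lift ord0 d) =
        b * (x p.1 (lift ord0 d) * x p.2 (lift ord0 d))) ->
      \sum_d flip_mx i x p.1 (lift ord0 d) * flip_mx i x p.2 (lift ord0 d) =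
      b * \sum_d x p.1 (lift ord0 d) * x p.2 (lift ord0 d).
    by move=> H; rewrite mulr_sumr; apply: eq_bigr.
  have [ip1|ip1] /= := eqVneq i p.1.
    rewrite (E (-1)) ?mulN1r// => d.
    by rewrite !mxE ip1 eqxx eq_sym (negbTE pN) mulNr mulN1r.
  have [ip2|ip2] /= := eqVneq i p.2.
    rewrite (E (-1)) ?mulN1r// => d.
    by rewrite !mxE ip2 eqxx (negbTE pN) mulrN mulN1r.
  rewrite (E 1) ?mul1r// => d.
  by rewrite !mxE ![_ == i]eq_sym (negbTE ip1) (negbTE ip2) mul1r.
have F_cont j (u : nat -> 'M[R]_(k, n.+1)) x : (forall q, unit_rows (u q)) ->
    unit_rows x -> (forall i d, (fun q => u q i d) @ \oo --> x i d) ->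
    (fun q => F j (u q)) @ \oo --> F j x.
  move=> u1 x1 ux; case: j => [[s i]|p] /=.
    exact: mean_parity_continuous.
  case: ifP => _; last exact: cvg_cst.
  apply: cvg_big => [|d _]; first exact: add_continuous.
  by apply: cvgM; exact: ux.
have {}ca : mcoeff a (\prod_(j <- js) \sum_i (c j i)%:R *: tvar i : polyA k) != 0.
  suff -> : \prod_(j <- js) (\sum_i (c j i)%:R *: tvar i : polyA k) =
      sprod m k l * \prod_(p <- prs) (tvar p.1 + tvar p.2) by [].
  rewrite big_cat !big_map big_allpairs; congr (_ * _).
    rewrite /sprod big_enum /=; apply: eq_big => [s //|s _].
    rewrite big_enum prodr_const card_ord; congr (_ ^+ _).
    by apply: eq_bigr => i _; rewrite scaler_nat.
  rewrite big_seq [RHS]big_seq; apply: eq_bigr => p /prsN pN /=.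
  rewrite pN (bigD1 p.1)//= (bigD1 p.2) 1?eq_sym//= !eqxx orbT !scale1r.
  rewrite big1 ?addr0// => i /andP[/negbTE -> /negbTE ->]; exact: scale0r.
have [x x1 xF] := common_zero F_flip F_cont an ca.
have xS (S : {set 'I_k}) i : (0 < #|S| <= l)%N -> mean_parity (mu i) S x = 0.
  move=> S0; pose s : {ffun 'I_k -> bool} := [ffun b => b \in S].
  have -> : S = [set b | s b]%SET by apply/setP => b; rewrite inE ffunE.
  apply: (xF (inl (s, i))); rewrite mem_cat; apply/orP; left.
  apply/map_f/allpairsP; exists (s, i); split; rewrite ?mem_enum//= unfold_in /P.
  suff -> : (\sum_(j < k) s j = #|S|)%N by [].
  rewrite -sum1_card [RHS]big_mkcond; apply: eq_bigr => b _.
  by rewrite ffunE; case: (b \in S).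
have [H [Hn Hl]] := any_equipart_zero m0 l0 mu_ac x1 xS.
exists H; split=> // p pP.
have pj : inr p \in js by rewrite mem_cat map_f ?orbT.
have := xF _ pj; rewrite /= prsN// => <-.
by apply: eq_bigr => d _; rewrite !Hn.
Qed.

End Main.

Theorem theorem9 (R : realType) (n m k l : nat)
    (hn : (0 < n)%N) (hm : (0 < m)%N) (hl : (1 <= l <= k)%N) :
  (~ in_ideal (fun i : 'I_k => tvar i ^+ n.+1) (sprod m k l) ->
   calM R n m k l)
  /\
  (forall q : polyA k,
     (\prod_(i < k) tvar i) * q = sprod m k l ->
     ~ in_ideal (fun j : 'I_k => wbar k (n%:Z - k%:Z + 1 + j%:Z)) q ->
     calMorth R n m k l).
Proof.
have /andP[l0 lk] := hl.
split=> [|q qE] notin; split=> // mu mu_ac.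
  have [a an ca] := notin_powers notin.
  have [|||H [_ Hl]] := @equipart_orthogonal R n m k l hm l0 mu mu_ac [::] a => //.
    by rewrite big_nil mulr1.
  by exists H.
(* If k > n, the class of degree 0, which is 1, is among the generators and the ideal is
   everything. *)
have kn : (k <= n)%N.
  rewrite leqNgt; apply/negP => nk; apply: notin.
  have jk : (k - n.+1 < k)%N by lia.
  have w1 : wbar k (n%:Z - k%:Z + 1 + (k - n.+1)%:Z) = 1.
    by rewrite (_ : _ + _ = 0) ?wbar0//; lia.
  have := in_idealM q (in_ideal_gen (fun j : 'I_k =>
    wbar k (n%:Z - k%:Z + 1 + j%:Z)) (Ordinal jk)).
  by rewrite [wbar _ _]w1 mulr1.
have [a an ca] := delta_notin_powers kn notin.
(* The factor t_1 ... t_k raises every exponent of [a] by one, from below [n] to at most [n]. *)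
pose b := mnm_add (\big[@mnm_add k/mnm0]_(i < k) mnm1 i) a.
have [|i||H [Ho Hl]] := @equipart_orthogonal R n m k l hm l0 mu mu_ac
  (enum [pred p : 'I_k * 'I_k | (p.1 < p.2)%N]) b.
- by move=> p; rewrite mem_enum inE; case: eqVneq => // ->; rewrite ltnn.
- rewrite mnmDE mnm_sumE (bigD1 i)//= mnm1E eqxx big1 ?addn0 ?add1n ?an//.
  by move=> j /negbTE ji; rewrite mnm1E ji.
- rewrite big_enum -/(delta k) -qE -mulrA mulrC /tvar mprodXE mcoeffMX.
  exact: ca.
exists H; split=> // i j ij.
have [ij'|ji|] := ltngtP i j.
- by apply: (Ho (i, j)); rewrite mem_enum inE.
- have := Ho (j, i); rewrite mem_enum inE => /(_ ji) /= <-.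
  by apply: eq_bigr => d _; rewrite mulrC.
- by move/val_inj => E; rewrite E eqxx in ij.
Qed.
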